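(* Let $P_n$ ($n\ge1$) and $P$ be probability measures on $(\mathbb{M}_{\mathbb{O}},\mathcal{M}_{\mathbb{O}})$. Then $P_n\to P$ weakly if and only if the finite-dimensional distributions of $P_n$ converge weakly to those of $P$, i.e. for every $k\ge1$ and all $A_1,\dots,A_k\in S_P$ the law of $(\xi(A_1),\dots,\xi(A_k))$ under $P_n$ converges weakly on $\mathbb{R}^k$ to its law under $P$.
   Context: Let $(\mathbb{S},d)$ be a complete separable metric space equipped with a scalar multiplication $[0,\infty)\times\mathbb{S}\to\mathbb{S}$, $(\lambda,x)\mapsto\lambda x$, and let $\mathbb{C}\subset\mathbb{S}$ be a closed cone (i.e. $\lambda\mathbb{C}=\mathbb{C}$ for all $\lambda>0$); put $\mathbb{O}=\mathbb{S}\setminus\mathbb{C}$. The scalar multiplication satisfies: $\lambda_1(\lambda_2x)=(\lambda_1\lambda_2)x$; $1x=x$; the map is jointly continuous; and if $x\in\mathbb{O}$ and $0\le\lambda_1<\lambda_2$ then $d(\lambda_1x,\mathbb{C})<d(\lambda_2x,\mathbb{C})$. For $r>0$ let $\mathbb{C}^r=\{x\in\mathbb{S}:d(x,\mathbb{C})<r\}$. $\mathcal{S}_{\mathbb{O}}$ denotes the Borel subsets of $\mathbb{S}$ contained in $\mathbb{O}$. A set $A\in\mathcal{S}_{\mathbb{O}}$ is bounded away from $\mathbb{C}$ if $A\subset\mathbb{S}\setminus\mathbb{C}^r$ for some $r>0$. $\mathcal{C}_{\mathbb{O}}$ is the class of nonnegative bounded continuous functions on $\mathbb{O}$ vanishing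 on $\mathbb{C}^r\cap\mathbb{O}$ for some $r>0$. $\mathbb{M}_{\mathbb{O}}$ is the set of Borel measures $\mu$ on $\mathcal{S}_{\mathbb{O}}$ with $\mu(\mathbb{S}\setminus\mathbb{C}^r)<\infty$ for every $r>0$; $\mu_n\to\mu$ in $\mathbb{M}_{\mathbb{O}}$ means $\int f\,d\mu_n\to\int f\,d\mu$ for all $f\in\mathcal{C}_{\mathbb{O}}$. This convergence is metrized by $d_{\mathbb{M}_{\mathbb{O}}}(\mu,\nu)=\int_0^\infty e^{-r}\frac{p_r(\mu^{(r)},\nu^{(r)})}{1+p_r(\mu^{(r)},\nu^{(r)})}\,dr$, where $\mu^{(r)}$ is the restriction of $\mu$ to $\mathbb{S}\setminus\mathbb{C}^r$ and $p_r$ is the Prohorov metric on finite Borel measures on $\mathbb{S}\setminus\mathbb{C}^r$; $\mathcal{M}_{\mathbb{O}}$ denotes the Borel $\sigma$-algebra of $(\mathbb{M}_{\mathbb{O}},d_{\mathbb{M}_{\mathbb{O}}})$, and weak convergence of probability measures on $\mathcal{M}_{\mathbb{O}}$ is with respect to this metric. For a probability measure $P$ on $\mathcal{M}_{\mathbb{O}}$, the class $S_P$ of stochastic continuity sets consists of those $A\in\mathcal{S}_{\mathbb{O}}$ bounded away from $\mathbb{C}$ with $P(\{\xi:\xi(\partial A)>0\})=0$, where $\partial A$ is the boundary of $A$. *)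

(* Defs.v *)
From HB Require Import structures.
From mathcomp Require Import all_boot all_order all_algebra.
From mathcomp Require Import all_classical all_reals all_analysis.
Set Implicit Arguments. Unset Strict Implicit. Unset Printing Implicit Defensive.
Import Order.TTheory GRing.Theory Num.Theory.
Import numFieldNormedType.Exports.
Local Open Scope classical_set_scope.
Local Open Scope ring_scope.

Section MetricSpaceDefs.
Context {R : realType} {S : Type} (d : S -> S -> R).

Definition is_metric : Prop :=
  [/\ forall x y, 0 <= d x y,
      forall x y, d x y = 0 <-> x = y,
      forall x y, d x y = d y x &
      forall x y z, d x z <= d x y + d y z].

Definition dball (x : S) (e : R) : set S := [set y | d x y < e].
Definition dopen (U : set S) : Prop :=
  forall x, U x -> exists2 e, 0 < e & dball x e `<=` U.
Definition dclosed (F : set S) : Prop := dopen (~` F).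
Definition dclosure (A : set S) : set S :=
  [set x | forall e, 0 < e -> exists2 y, A y & d x y < e].
Definition dinterior (A : set S) : set S :=
  [set x | exists2 e, 0 < e & dball x e `<=` A].
Definition dboundary (A : set S) : set S := dclosure A `\` dinterior A.

Definition dcauchy (u : nat -> S) : Prop :=
  forall e, 0 < e -> exists N, forall m n, (N <= m)%N -> (N <= n)%N -> d (u m) (u n) < e.
Definition dconverges (u : nat -> S) (x : S) : Prop :=
  forall e, 0 < e -> exists N, forall n, (N <= n)%N -> d (u n) x < e.
Definition dcomplete : Prop := forall u, dcauchy u -> exists x, dconverges u x.
Definition dseparable : Prop :=
  exists2 D : set S, countable D &
    forall x e, 0 < e -> exists2 y, D y & d x y < e.

(* distance from a point to a set (inf over the empty set is +oo) *)
Definition dist (x : S) (A : set S) : \bar R :=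
  ereal_inf [set (d x y)%:E | y in A].

Definition dborel : set (set S) := <<s dopen >>.

Variable C : set S.

Definition Cr (r : R) : set S := [set x | (dist x C < r%:E)%E].

Definition smul_axioms (smul : R -> S -> S) : Prop :=
  [/\ forall a b x, 0 <= a -> 0 <= b -> smul a (smul b x) = smul (a * b) x,
      forall x, smul 1 x = x,
      forall a x e, 0 <= a -> 0 < e -> exists2 dl, 0 < dl &
          forall b y, 0 <= b -> `|b - a| < dl -> d x y < dl ->
            d (smul b y) (smul a x) < e &
      forall x a b, ~ C x -> 0 <= a -> a < b ->
          (dist (smul a x) C < dist (smul b x) C)%E].

Definition closed_cone (smul : R -> S -> S) : Prop :=
  dclosed C /\ forall l, 0 < l -> smul l @` C = C.

Definition BorelO (A : set S) : Prop := dborel A /\ A `<=` ~` C.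

(* mu is a Borel measure on S_O (extended by 0 outside S_O)
   with mu(S \ C^r) < oo for all r > 0 *)
Definition isMO (mu : set S -> \bar R) : Prop :=
  [/\ forall A, ~ BorelO A -> mu A = 0%E,
      forall A, BorelO A -> (0 <= mu A)%E,
      mu set0 = 0%E,
      forall F : nat -> set S, (forall n, BorelO (F n)) -> trivIset setT F ->
        (fun n => (\sum_(0 <= i < n) mu (F i))%E) @ \oo --> mu (\bigcup_n F n) &
      forall r, 0 < r -> (mu (~` Cr r) < +oo)%E].

Lemma isMO0 : isMO (fun _ => 0%E).
Proof.
split => //; try (by move=> r _; exact: ltry);
  by move=> F _ _; under eq_fun do rewrite big1 //; exact: cvg_cst.
Qed.

(* Prohorov metric between mu^(r) and nu^(r), finite measures on S \ C^r *)
Definition nbhd_set (F : set S) (e : R) : set S := [set x | (dist x F < e%:E)%E].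
Definition prohorov_r (mu nu : set S -> \bar R) (r : R) : R :=
  inf [set e : R | 0 < e /\ forall F, dclosed F -> F `<=` ~` Cr r ->
     (mu F <= nu (nbhd_set F e `&` ~` Cr r) + e%:E)%E /\
     (nu F <= mu (nbhd_set F e `&` ~` Cr r) + e%:E)%E].

Definition dM_fun (mu nu : set S -> \bar R) : R :=
  fine (\int[@lebesgue_measure R]_(r in `]0%R, +oo[%classic)
          (expR (- r) * (prohorov_r mu nu r / (1 + prohorov_r mu nu r)))%:E)%E.

End MetricSpaceDefs.

Section MOspace.
Context {R : realType} {S : Type} (d : S -> S -> R) (C : set S).

Definition MO : Type := {mu : set S -> \bar R | isMO d C mu}.

HB.instance Definition _ := gen_eqMixin MO.
HB.instance Definition _ := gen_choiceMixin MO.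
HB.instance Definition _ := isPointed.Build MO (exist _ _ (isMO0 d C)).

Definition dMO (m n : MO) : R := dM_fun d C (proj1_sig m) (proj1_sig n).

Definition dMopen (U : set MO) : Prop :=
  forall m, U m -> exists2 e, 0 < e & forall n, dMO m n < e -> U n.

Definition MOB : Type := g_sigma_algebraType dMopen.

Definition dMcontinuous (f : MO -> R) : Prop :=
  forall m e, 0 < e -> exists2 dl, 0 < dl &
    forall n, dMO m n < dl -> `|f n - f m| < e.

Definition weak_conv (P_ : nat -> probability MOB R) (P : probability MOB R) : Prop :=
  forall f : MOB -> R, (exists M, forall m, `|f m| <= M) -> dMcontinuous f ->
    (fun n => \int[P_ n]_x (f x)%:E)%E @ \oo --> (\int[P]_x (f x)%:E)%E.

Definition SP (P : probability MOB R) (A : set S) : Prop :=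
  [/\ BorelO d C A,
      exists2 r, 0 < r & A `<=` ~` Cr d C r &
      P [set m : MOB | (0 < proj1_sig m (dboundary d A))%E] = 0%E].

Definition fidi (m : MOB) (k : nat) (A : 'I_k -> set S) : 'rV[R]_k :=
  \row_i fine (proj1_sig m (A i)).

Definition fidi_conv (P_ : nat -> probability MOB R) (P : probability MOB R) : Prop :=
  forall k, (0 < k)%N -> forall A : 'I_k -> set S, (forall i, SP P (A i)) ->
    forall g : 'rV[R]_k -> R, (exists M, forall v, `|g v| <= M) -> continuous g ->
      (fun n => \int[P_ n]_x (g (fidi x A))%:E)%E @ \oo -->
        (\int[P]_x (g (fidi x A))%:E)%E.

End MOspace.

(* Main.v *)
(** No tightness is needed. Let [A_i] be countably many P-continuity sets, closed
    under finite unions and filling up every open subset of O from inside, together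
    with the sets {d(.,C) > r} for arbitrarily small r. By the portmanteau argument,
    m_k(A_i) -> m(A_i) for all i forces m_k -> m in M_O. Hence, for f bounded and
    continuous on M_O, the inf-convolutions
      f_J(m) = inf_n (f(n) + J * sum_(i < J) |m(A_i) - n(A_i)|)
    depend on finitely many masses, lie below f and converge to f, so that
    convergence of the finite-dimensional distributions gives liminf E_n f >= E f;
    apply this to f and - f.

    The converse is the same argument for h(m) = g(m(A_1), ..., m(A_k)), with
    |m(A_i) - n(A_i)| replaced by the distance of n(A_i) to an interval whose ends
    are continuous in m and shrink to m(A_i) when m does not charge the boundary
    of A_i. *)

(* The inf-convolutions lie below [f] at every measure, hence under every [P_ n], whereas their
   convergence to [f] is needed only under [P]; so [J] is fixed before [n] grows and nothing uniform
   in [n] is required. The penalty factor gives that convergence: a near-minimiser pays at most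
   [2 * M + 1], so on each fixed [A i] its mass is within [2 * M + 1] over that factor of the mass
   of [m], and it tends to [m]. The converse cannot put [m(A_i)] itself into the penalty, because
   masses are only semicontinuous in [m]: lower on open sets, upper on closed ones. The ends of the
   interval therefore approach the mass of the interior from below and that of the closure from
   above. Their continuity must come from a distance that integrates over radii: closeness of two
   measures yields Prohorov closeness at some uncontrolled radius in []0, r0[]. This suffices for
   sets at distance at least [r0] from [C], which are admissible at every smaller radius. *)
Require Import Defs.
From HB Require Import structures.
From mathcomp Require Import all_boot all_order all_algebra.
From mathcomp Require Import all_classical all_reals all_analysis.
From mathcomp Require Import measurable_realfun ring lra.
Import Order.TTheory GRing.Theory Num.Theory.
Import numFieldNormedType.Exports.
Local Open Scope classical_set_scope.
Local Open Scope ring_scope.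

(** * Integrals and inf-convolutions *)

(* The integrand of [dM_fun] need not be measurable in [r]; the integral of a
   nonnegative function is then the lower integral, for which monotonicity and
   dominated convergence to 0 still hold. *)
Section LowerIntegral.
Context {dT : measure_display} {T : measurableType dT} {R : realType}.
Variable mu : {measure set T -> \bar R}.
Import HBNNSimple.

Lemma le_lower_integral (f g : T -> \bar R) :
  (forall x, 0 <= f x)%E -> (forall x, f x <= g x)%E ->
  (\int[mu]_x f x <= \int[mu]_x g x)%E.
Proof.
move=> f0 fg; rewrite !ge0_integralTE//; last by move=> x; exact: le_trans (fg x).
apply: ereal_sup_le => _ [h /= hf <-]; exists h => //= x.
exact: le_trans (fg x).
Qed.

(** Simple functions [h k <= F k] whose integrals come within [1 / (k + 1)] of those of [F k] are
    measurable, and dominated convergence applies to them. The limit 0 matters: [h k] is squeezed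
    between 0 and [F k]. *)
Lemma lower_dominated_cvg0 (F : nat -> T -> R) (g : T -> R) :
  (forall k x, 0 <= F k x) -> (forall k x, F k x <= g x) ->
  mu.-integrable setT (EFin \o g) ->
  {ae mu, forall x, F k x @[k --> \oo] --> 0} ->
  (\int[mu]_x (F k x)%:E)%E @[k --> \oo] --> 0%E.
Proof.
move=> F0 Fg ig F_0.
have Ig k : (\int[mu]_x (F k x)%:E)%E \is a fin_num.
  rewrite ge0_fin_numE; last by apply: integral_ge0 => x _; rewrite lee_fin.
  apply: (@le_lt_trans _ _ (\int[mu]_x (g x)%:E)%E).
    by apply: le_lower_integral => x; rewrite lee_fin.
  case/integrableP : ig => _; apply: le_lt_trans.
  by apply: le_lower_integral => x; rewrite ?lee_fin ?(le_trans (F0 0%N x))//= ler_norm.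
have hP k : exists h : {nnsfun T >-> R}, (forall x, h x <= F k x) /\
    (\int[mu]_x (F k x)%:E <= \int[mu]_x (h x)%:E + (k.+1%:R^-1)%:E)%E.
  have Ik := Ig k; rewrite ge0_integralTE in Ik; last by move=> x; rewrite lee_fin.
  have k0 : 0 < k.+1%:R^-1 :> R by rewrite invr_gt0.
  have [_ [h /= hF <-]] := ub_ereal_sup_adherent k0 Ik.
  rewrite -ge0_integralTE; last by move=> x; rewrite lee_fin.
  rewrite EFinN lteBlDr// => /ltW hI; exists h; split; first by move=> x; rewrite -lee_fin.
  by rewrite integralT_nnsfun.
pose h k := projT1 (cid (hP k)).
have hF k x : h k x <= F k x by have [] := projT2 (cid (hP k)).
have hI k : (\int[mu]_x (F k x)%:E <= \int[mu]_x (h k x)%:E + (k.+1%:R^-1)%:E)%E.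
  by have [] := projT2 (cid (hP k)).
have /= h0 : (\int[mu]_x (h k x)%:E)%E @[k --> \oo] --> (\int[mu]_(x in [set: T]) cst 0 x)%E.
  have [] // := @dominated_convergence _ T R mu setT measurableT
    (fun k x => (h k x)%:E) (cst 0%E) (EFin \o g).
  - by move=> k; apply/measurable_EFinP.
  - apply: filterS F_0 => x Fx _; apply: cvg_EFin; first exact: nearW.
    apply: squeeze_cvgr (cvg_cst 0) Fx; apply: nearW => k.
    by rewrite /= hF andbT.
  - by apply: aeW => x k _; rewrite /= lee_fin ger0_norm// (le_trans (hF _ _)).
rewrite integral0 in h0.
apply: (@squeeze_cvge _ _ _ _ (cst 0%E) _ (fun k => \int[mu]_x (h k x)%:E + (k.+1%:R^-1)%:E)%E).
- by apply: nearW => k; rewrite hI andbT; apply: integral_ge0 => x _; rewrite lee_fin.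
- exact: cvg_cst.
- rewrite -[X in _ --> X]adde0; apply: cvgeD => //.
  by apply: cvg_EFin; [exact: nearW|exact: cvg_harmonic].
Qed.

End LowerIntegral.

(** At most [c * (n + 1)] points can have weight above [1 / (n + 1)]. *)
Lemma countable_sum_bounded_gt0 {R : realType} (w : R -> R) (D : set R) (c : R) :
  (forall s : seq R, uniq s -> (forall t, t \in s -> D t) -> \sum_(t <- s) w t <= c) ->
  countable [set t | D t /\ 0 < w t].
Proof.
move=> h.
have -> : [set t | D t /\ 0 < w t] = \bigcup_n [set t | D t /\ n.+1%:R^-1 < w t].
  apply/seteqP; split => [t [Dt wt]|t [n _ [Dt nt]]]; last first.
    by split => //; apply: lt_trans nt; rewrite invr_gt0.
  have wt1 : 0 <= (w t)^-1 by rewrite invr_ge0 ltW.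
  exists (Num.bound (w t)^-1) => //; split => //.
  rewrite -[ltRHS]invrK ltf_pV2 ?posrE ?invr_gt0//.
  by apply: lt_trans (archi_boundP wt1) _; rewrite ltr_nat.
apply: bigcup_countable => // n _; apply: finite_set_countable.
apply: contrapT => /infinite_set_fset infD.
have c0 : 0 <= c by have := h [::]; rewrite big_nil; exact.
have cn0 : 0 <= c * n.+1%:R by rewrite mulr_ge0.
have [B BD nB] := infD (Num.bound (c * n.+1%:R)).
have := h (finmap.enum_fset B) (finmap.fset_uniq B) (fun t tB => (BD t tB).1).
apply/negP; rewrite -ltNge.
apply: (@lt_le_trans _ _ (\sum_(t <- finmap.enum_fset B) n.+1%:R^-1)); last first.
  by rewrite big_seq [leRHS]big_seq; apply: ler_sum => t tB; apply/ltW/(BD t tB).2.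
rewrite big_const_seq count_predT iter_addr addr0 -[ltRHS]mulr_natl ltr_pdivlMr//.
by apply: lt_le_trans (archi_boundP cn0) _; rewrite ler_nat.
Qed.

Section Regularization.
Context {T : pointedType} {R : realType}.
Implicit Types (h w : T -> R).

(** The penalty is an arbitrary function instead of a distance to a base point: one implication
    parametrises it by a vector of reals, the other by a measure. *)
Definition reg h w : R := inf [set h t + w t | t in setT].

Context {h : T -> R} {M : R}.
Hypothesis hM : forall t, `|h t| <= M.

Let reg_has_inf w : (forall t, 0 <= w t) -> has_inf [set h t + w t | t in setT].
Proof.
move=> w0; split; first by exists (h point + w point), point.
exists (- M) => _ [t _ <-].
by have := hM t; rewrite ler_norml => /andP[? _]; rewrite ler_wpDr.
Qed.

Lemma reg_le {w} t : (forall t, 0 <= w t) -> reg h w <= h t + w t.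
Proof. by move=> /reg_has_inf[_ lb]; apply: ge_inf => //; exists t. Qed.

Lemma reg_ge {w} : (forall t, 0 <= w t) -> - M <= reg h w.
Proof.
move=> w0; apply: lb_le_inf; first by case: (reg_has_inf w w0).
move=> _ [t _ <-].
by have := hM t; rewrite ler_norml => /andP[? _]; rewrite ler_wpDr.
Qed.

(** Penalties may be unbounded in [t]; a bound on their difference uniform in [t] is all that
    continuity of the infimum needs. *)
Lemma reg_lip {w w' dl} : (forall t, 0 <= w t) -> (forall t, 0 <= w' t) ->
  (forall t, `|w t - w' t| <= dl) -> `|reg h w - reg h w'| <= dl.
Proof.
have half w1 w2 : (forall t, 0 <= w1 t) -> (forall t, 0 <= w2 t) ->
    (forall t, w1 t - w2 t <= dl) -> reg h w1 - reg h w2 <= dl.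
  move=> w10 w20 ww; rewrite lerBlDr -lerBlDl; apply: lb_le_inf.
    by case: (reg_has_inf w2 w20).
  by move=> _ [t _ <-]; have := ww t; have := reg_le t w10; lra.
move=> w0 w'0 ww; rewrite ler_norml; apply/andP; split.
  rewrite lerNl opprB; apply: half => // t.
  by have := ww t; rewrite ler_norml => /andP[]; lra.
by apply: half => // t; have := ww t; rewrite ler_norml => /andP[].
Qed.

(** Only near-minimisers have to be controlled. Being within 1 of the infimum, they satisfy
    [h t + w t <= h x + 1], and [|h| <= M] turns this into the bound [2 * M + 1] on the penalty. *)
Lemma reg_cvg {w_ : nat -> T -> R} x : (forall J t, 0 <= w_ J t) -> (forall J, w_ J x = 0) ->
  (forall t_ : nat -> T, (forall J, w_ J (t_ J) <= 2 * M + 1) -> h (t_ J) @[J --> \oo] --> h x) ->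
  reg h (w_ J) @[J --> \oo] --> h x.
Proof.
move=> w0 wx hcv.
have ex J : exists t, h t + w_ J t < reg h (w_ J) + J.+1%:R^-1.
  have J0 : 0 < J.+1%:R^-1 :> R by rewrite invr_gt0.
  by have [_ [t _ <-] ht] := inf_adherent J0 (reg_has_inf (w_ J) (w0 J)); exists t.
pose t_ J := projT1 (cid (ex J)).
have tP J : h (t_ J) + w_ J (t_ J) < reg h (w_ J) + J.+1%:R^-1 := projT2 (cid (ex J)).
have le_x J : reg h (w_ J) <= h x by have := reg_le x (w0 J); rewrite wx addr0.
have tx : h (t_ J) @[J --> \oo] --> h x.
  apply: hcv => J; have := tP J; have := le_x J.
  have : J.+1%:R^-1 <= 1 :> R by rewrite invf_le1// ler1n.
  have := hM x; have := hM (t_ J); rewrite !ler_norml => /andP[? _] /andP[_ ?].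
  by set q := J.+1%:R^-1; lra.
apply: (@squeeze_cvgr _ _ _ _ (fun J => h (t_ J) - J.+1%:R^-1) (fun=> h x)).
- apply: nearW => J; rewrite le_x andbT; have := tP J; have := w0 J (t_ J).
  by set q := J.+1%:R^-1; lra.
- by rewrite -[X in _ --> X]subr0; apply: cvgB => //; exact: cvg_harmonic.
- exact: cvg_cst.
Qed.

End Regularization.

Section ApproximationFromBelow.
Context {dT : measure_display} {T : measurableType dT} {R : realType}.
Implicit Types (f : T -> R) (P : probability T R).

Definition bounded_measurable f :=
  measurable_fun setT f /\ exists M, forall t, `|f t| <= M.

Lemma bounded_measurable_integrable P {f} : bounded_measurable f ->
  P.-integrable setT (EFin \o f).
Proof.
move=> [mf [M fM]]; apply: (@le_integrable _ _ _ P setT measurableT _ (cst M%:E)).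
- exact/measurable_EFinP.
- move=> x _; rewrite /= lee_fin; apply: le_trans (fM x) _; exact: ler_norm.
- exact: finite_measure_integrable_cst.
Qed.

Definition expect P f : R := fine (\int[P]_x (f x)%:E).

Lemma expectE P {f} : bounded_measurable f -> (\int[P]_x (f x)%:E)%E = (expect P f)%:E.
Proof.
by move=> bf; rewrite fineK// ; apply: integrable_fin_num => //; exact: bounded_measurable_integrable.
Qed.

Lemma le_expect P {f g} : bounded_measurable f -> bounded_measurable g ->
  (forall x, f x <= g x) -> expect P f <= expect P g.
Proof.
move=> bf bg fg; rewrite -lee_fin -!expectE//; apply: le_integral => //.
- exact: bounded_measurable_integrable.
- exact: bounded_measurable_integrable.
- by move=> x _; rewrite lee_fin.
Qed.

Lemma expectN P {f} : bounded_measurable f -> expect P (fun x => - f x) = - expect P f.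
Proof.
move=> bf; rewrite /expect; under eq_integral do rewrite EFinN.
rewrite integralN/= ?fineN//; apply: integrable_add_def => //.
exact: bounded_measurable_integrable.
Qed.

(** Dominated convergence under [P] fixes one [J] at a cost of [e / 2]; for that [J] the
    expectations converge in [n], and [h_ J <= h] passes the bound on to [h] under each [P_ n]. *)
Lemma expect_liminf (P_ : nat -> probability T R) P h (h_ : nat -> T -> R) M :
  bounded_measurable h -> (forall J, measurable_fun setT (h_ J)) ->
  (forall J t, `|h_ J t| <= M) -> (forall J t, h_ J t <= h t) ->
  {ae P, forall t, h_ J t @[J --> \oo] --> h t} ->
  (forall J, (\int[P_ n]_x (h_ J x)%:E)%E @[n --> \oo] --> (\int[P]_x (h_ J x)%:E)%E) ->
  forall e, 0 < e -> \forall n \near \oo, expect P h - e < expect (P_ n) h.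
Proof.
move=> bh mh_ h_M h_h ae_h P_P e e0.
have bh_ J : bounded_measurable (h_ J) by split => //; exists M.
have cvgP : expect P (h_ J) @[J --> \oo] --> expect P h.
  have [] // := @dominated_convergence _ T R P setT measurableT
    (fun J x => (h_ J x)%:E) (EFin \o h) (cst M%:E).
  - by move=> J; exact/measurable_EFinP.
  - by apply/measurable_EFinP; case: bh.
  - by apply: filterS ae_h => x hx _; apply: cvg_EFin => //; exact: nearW.
  - exact: finite_measure_integrable_cst.
  - by apply: aeW => x J _; rewrite /= lee_fin.
  by move=> _ _; rewrite /= expectE// => /fine_cvg.
have e2 : 0 < e / 2 by rewrite divr_gt0.
move: cvgP => /cvgr_gt /(_ (expect P h - e / 2)); rewrite ltrBlDr ltrDl => /(_ e2)[J _ /(_ J (leqnn J)) hJ].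
have := P_P J; rewrite expectE// => /fine_cvg.
move=> /cvgr_gt /(_ (expect P (h_ J) - e / 2)); rewrite ltrBlDr ltrDl => /(_ e2).
apply: filterS => n /=; rewrite -/(expect _ _) => hn.
have := le_expect (P_ n) (bh_ J) bh (h_h J).
by rewrite /= in hJ; lra.
Qed.

Lemma cvg_expect (P_ : nat -> probability T R) P h : bounded_measurable h ->
  (forall e, 0 < e -> \forall n \near \oo, expect P h - e < expect (P_ n) h) ->
  (forall e, 0 < e -> \forall n \near \oo,
    expect P (fun x => - h x) - e < expect (P_ n) (fun x => - h x)) ->
  (\int[P_ n]_x (h x)%:E)%E @[n --> \oo] --> (\int[P]_x (h x)%:E)%E.
Proof.
move=> bh h1 h2; rewrite expectE//; under eq_cvg do rewrite expectE//.
apply: cvg_EFin; first exact: nearW.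
apply/cvgrPdist_lt => e e0; apply: filterS2 (h1 e e0) (h2 e e0) => n /=.
by rewrite !expectN// ltr_norml; lra.
Qed.

End ApproximationFromBelow.

(** * Metric preliminaries *)

Section Space.
Context {R : realType} {S : pointedType} (d : S -> S -> R).
Hypothesis hm : is_metric d.

Lemma d_ge0 x y : 0 <= d x y. Proof. by case: hm. Qed.
Lemma dxx x : d x x = 0. Proof. by case: hm => _ h _ _; exact/h. Qed.
Lemma d_sym x y : d x y = d y x. Proof. by case: hm. Qed.
Lemma d_tri y x z : d x z <= d x y + d y z. Proof. by case: hm. Qed.

(** A real-valued counterpart of [dist]. The two differ on the empty set, where [distR] is 0 and
    [dist] is [+oo]; hence the assumptions [A !=set0] below. *)
Definition distR (A : set S) (x : S) : R := inf [set d x y | y in A].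

Lemma distR_has_inf {A} x : A !=set0 -> has_inf [set d x y | y in A].
Proof.
move=> [a Aa]; split; first by exists (d x a), a.
by exists 0 => _ [y _ <-]; exact: d_ge0.
Qed.

Lemma distR_lt {A} x e : A !=set0 -> (distR A x < e) <-> exists2 y, A y & d x y < e.
Proof.
move=> A0; split.
  by move=> /(inf_lt (distR_has_inf x A0).1) [_ [y Ay <-] xy]; exists y.
move=> [y Ay xy]; apply: le_lt_trans xy; apply: ge_inf; last by exists y.
by have [] := distR_has_inf x A0.
Qed.

Lemma distR_le {A} x {y} : A y -> distR A x <= d x y.
Proof.
move=> Ay; rewrite leNgt; apply/negP => h.
by have := (distR_lt x (distR A x) (ex_intro _ y Ay)).2; rewrite ltxx; case/(_ _)/notF; exists y.
Qed.

Lemma distR_ge0 A x : 0 <= distR A x.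
Proof.
have [->|/set0P A0] := eqVneq A set0; first by rewrite /distR image_set0 inf0.
rewrite leNgt; apply/negP => /(distR_lt x 0 A0)[y _].
by rewrite ltNge d_ge0.
Qed.

Lemma dist_lt x A e :
  (dist d x A < e%:E)%E <-> exists2 y, A y & d x y < e.
Proof.
split.
  by move=> /ereal_inf_lt [_ [y Ay <-]]; rewrite lte_fin => xy; exists y.
move=> [y Ay xy]; apply: (@le_lt_trans _ _ (d x y)%:E); last by rewrite lte_fin.
by apply: ereal_inf_lbound; exists y.
Qed.

Definition lip1 (f : S -> R) := forall x y, f x - f y <= d x y.

Lemma lip1N {f} : lip1 f -> lip1 (fun x => - f x).
Proof. by move=> h x y; rewrite opprK addrC d_sym; exact: h. Qed.

Lemma lip1_distR {A} : A !=set0 -> lip1 (distR A).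
Proof.
move=> A0 x y; rewrite lerBlDr; apply/ler_addgt0Pr => e e0.
have /(distR_lt y _ A0)[z Az yz] : distR A y < distR A y + e by rewrite ltrDl.
rewrite (le_trans (distR_le x Az))// (le_trans (d_tri y _ _))//.
by rewrite -addrA lerD2l ltW.
Qed.

Lemma lip1_d x : lip1 (d x).
Proof. by move=> y z; have := d_tri z x y; rewrite (d_sym z y); lra. Qed.

Lemma dopen_gt {f} t : lip1 f -> dopen d [set x | t < f x].
Proof.
move=> fl x /= tx; exists (f x - t); first by lra.
by move=> y /=; rewrite /dball/=; have := fl x y; lra.
Qed.

Lemma dopen_lt {f} t : lip1 f -> dopen d [set x | f x < t].
Proof.
move=> /lip1N /(@dopen_gt _ (- t)); congr dopen.
by apply/seteqP; split => x /=; rewrite ltrN2.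
Qed.

Lemma dclosed_ge {f} t : lip1 f -> dclosed d [set x | t <= f x].
Proof.
move=> /(@dopen_lt _ t); rewrite /dclosed; congr dopen.
by apply/seteqP; split => x /=; rewrite ltNge => /negP.
Qed.

Lemma dopen_bigcup {I : Type} {P : set I} {F : I -> set S} :
  (forall i, P i -> dopen d (F i)) -> dopen d (\bigcup_(i in P) F i).
Proof.
move=> h x [i Pi Fx]; have [e e0 be] := h _ Pi _ Fx.
by exists e => // y /be; exists i.
Qed.

Lemma dopenI {A B} : dopen d A -> dopen d B -> dopen d (A `&` B).
Proof.
move=> oA oB x [/oA[e e0 he] /oB[f f0 hf]].
exists (Num.min e f); first by rewrite lt_min e0.
by move=> y; rewrite /dball/= lt_min => /andP[/he ? /hf].
Qed.

Lemma dopenU {A B} : dopen d A -> dopen d B -> dopen d (A `|` B).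
Proof.
move=> oA oB x [/oA[e e0 he]|/oB[e e0 he]]; exists e => // y /he; [by left|by right].
Qed.

Lemma dclosedI {A B} : dclosed d A -> dclosed d B -> dclosed d (A `&` B).
Proof. by rewrite /dclosed setCI; exact: dopenU. Qed.

Lemma dclosedD {A B} : dclosed d A -> dopen d B -> dclosed d (A `\` B).
Proof. by move=> cA oB; apply: dclosedI => //; rewrite /dclosed setCK. Qed.

Lemma dopenD {A B} : dopen d A -> dclosed d B -> dopen d (A `\` B).
Proof. by move=> oA cB; apply: dopenI. Qed.

Lemma dopen0 : dopen d set0. Proof. by []. Qed.

Lemma dborel_open {A} : dopen d A -> dborel d A.
Proof. exact: sub_sigma_algebra. Qed.

Lemma dborelC {A} : dborel d A -> dborel d (~` A).
Proof. exact: sigma_algebraC. Qed.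

Lemma dborel_closed {A} : dclosed d A -> dborel d A.
Proof. by move=> /dborel_open/dborelC; rewrite setCK. Qed.

Lemma dborelI {A B} : dborel d A -> dborel d B -> dborel d (A `&` B).
Proof. exact: (@measurableI _ (g_sigma_algebraType (dopen d))). Qed.

Lemma dborelU {A B} : dborel d A -> dborel d B -> dborel d (A `|` B).
Proof. exact: (@measurableU _ (g_sigma_algebraType (dopen d))). Qed.

Lemma dborelD {A B} : dborel d A -> dborel d B -> dborel d (A `\` B).
Proof. exact: (@measurableD _ (g_sigma_algebraType (dopen d))). Qed.

Lemma dclosure_closed A : dclosed d (dclosure d A).
Proof.
move=> x /= nx; apply: contrapT => h; apply: nx => e e0.
have [y /= cy xy] : exists2 y, dclosure d A y & d x y < e / 2.
  apply: contrapT => h2; apply: h; exists (e / 2); first by lra.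
  by move=> y /= xy cy; apply: h2; exists y.
have [z Az yz] := cy (e / 2) ltac:(lra).
by exists z => //; have := d_tri y x z; lra.
Qed.

Lemma sub_dclosure A : A `<=` dclosure d A.
Proof. by move=> x Ax e e0; exists x; rewrite ?dxx. Qed.

Lemma dclosure_sub {A F} : dclosed d F -> A `<=` F -> dclosure d A `<=` F.
Proof.
move=> cF AF x cx; apply: contrapT => /cF[e e0 he].
by have [y /AF Fy /he] := cx e e0.
Qed.

Lemma dinterior_open A : dopen d (dinterior d A).
Proof.
move=> x [e e0 he]; exists (e / 2); first by lra.
move=> y; rewrite /dball/= => xy; exists (e / 2); first by lra.
by move=> z; rewrite /dball/= => yz; apply: he; rewrite /dball/=; have := d_tri y x z; lra.
Qed.

Lemma dinterior_sub A : dinterior d A `<=` A.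
Proof. by move=> x [e e0]; apply; rewrite /dball/= dxx. Qed.

Lemma dinterior_max {A U} : dopen d U -> U `<=` A -> U `<=` dinterior d A.
Proof. by move=> oU UA x /oU[e e0 he]; exists e => // y /he/UA. Qed.

Lemma dboundary_closed A : dclosed d (dboundary d A).
Proof. exact: dclosedD (@dclosure_closed A) (@dinterior_open A). Qed.

Lemma dboundary_sub {A F} : dclosed d F -> A `<=` F -> dboundary d A `<=` F.
Proof. by move=> cF /(dclosure_sub cF) h x [/h]. Qed.

(** Off the closure of [A], the union coincides with [B] near [x]. *)
Lemma dboundaryU A B : dboundary d (A `|` B) `<=` dboundary d A `|` dboundary d B.
Proof.
move=> x [cx ix].
have [cA|ncA] := pselect (dclosure d A x).
  left; split => // -[e e0 he]; apply: ix; exists e => // y /he; by left.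
right; split => [e e0|[e e0 he]]; last by apply: ix; exists e => // y /he; right.
have [f f0 hf] : exists2 f, 0 < f & forall y, A y -> f <= d x y.
  apply: contrapT => h; apply: ncA => f f0; apply: contrapT => h2; apply: h.
  by exists f => // y Ay; rewrite leNgt; apply/negP => xy; apply: h2; exists y.
have mef : 0 < Num.min e f by rewrite lt_min e0.
have [y + ] := cx _ mef; rewrite lt_min => ABy /andP[xe xf].
by case: ABy => [/hf|By]; [rewrite leNgt xf|exists y].
Qed.

Lemma distR_gt0 {F x} : F !=set0 -> dclosed d F -> ~ F x -> 0 < distR F x.
Proof.
move=> F0 cF /cF[e e0 he]; apply: (lt_le_trans e0).
rewrite leNgt; apply/negP => /(distR_lt x _ F0)[y Fy xy].
by have := he _ xy.
Qed.

Lemma distR_eq0 {F x} : F x -> distR F x = 0.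
Proof. by move=> Fx; apply/eqP; rewrite eq_le distR_ge0 (le_trans (distR_le x Fx))// dxx. Qed.

Variable C : set S.
Hypotheses (Cc : dclosed d C) (C0 : C !=set0).

Lemma CrE r : Cr d C r = [set x | distR C x < r].
Proof.
apply/seteqP; split => x /=; first by move/dist_lt => h; exact/distR_lt.
by move/(distR_lt x r C0) => h; exact/dist_lt.
Qed.

Lemma CrCE r : ~` Cr d C r = [set x | r <= distR C x].
Proof. by rewrite CrE; apply/seteqP; split => x /=; rewrite leNgt => /negP. Qed.

Lemma CrC_closed r : dclosed d (~` Cr d C r).
Proof. by rewrite CrCE; apply: dclosed_ge; exact: lip1_distR. Qed.

Lemma CrC_sub {r s} : r <= s -> ~` Cr d C s `<=` ~` Cr d C r.
Proof. by move=> rs; rewrite !CrCE => x /=; exact: le_trans. Qed.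

Lemma CrC_subC {r} : 0 < r -> ~` Cr d C r `<=` ~` C.
Proof. by move=> r0; rewrite CrCE => x /= rx Cx; move: rx; rewrite distR_eq0// leNgt r0. Qed.

Definition baway (A : set S) := exists2 r, 0 < r & A `<=` ~` Cr d C r.

(** Every element of [MO] is finite on these sets ([bO_fin]), so passing to real-valued masses by
    [fine] loses nothing there. *)
Definition bO (A : set S) := dborel d A /\ baway A.

Lemma bO_BorelO {A} : bO A -> BorelO d C A.
Proof. by move=> [bA [r r0 Ar]]; split => //; apply: subset_trans Ar (CrC_subC r0). Qed.

Lemma baway_sub {A B} : A `<=` B -> baway B -> baway A.
Proof. by move=> AB [r r0 h]; exists r => //; exact: subset_trans h. Qed.

Lemma bawayU {A B} : baway A -> baway B -> baway (A `|` B).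
Proof.
move=> [r r0 Ar] [s s0 Bs]; exists (Num.min r s); first by rewrite lt_min r0.
by move=> x [/Ar|/Bs]; apply: CrC_sub; rewrite ge_min lexx ?orbT.
Qed.

Lemma bOU {A B} : bO A -> bO B -> bO (A `|` B).
Proof. by move=> [? ?] [? ?]; split; [exact: dborelU|exact: bawayU]. Qed.

Lemma bO_sub {A B} : dborel d A -> A `<=` B -> bO B -> bO A.
Proof. by move=> bA AB [_ /(baway_sub AB)]. Qed.

Lemma bOD {A B} : bO A -> dborel d B -> bO (A `\` B).
Proof. by move=> oA bB; apply: (bO_sub _ _ oA); [apply: dborelD => //; case: oA|exact: subDsetl]. Qed.

Lemma bOI {A B} : bO A -> dborel d B -> bO (A `&` B).
Proof. by move=> oA bB; apply: (bO_sub _ _ oA); [apply: dborelI => //; case: oA|exact: subIsetl]. Qed.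

Lemma bO0 : bO set0.
Proof.
split; first exact: (dborel_open (@dopen0)).
by exists 1 => // x.
Qed.

Lemma bO_CrC {r} : 0 < r -> bO (~` Cr d C r).
Proof. by move=> r0; split; [exact: dborel_closed (@CrC_closed r)|exists r]. Qed.

Lemma baway_dclosure {A} : baway A -> baway (dclosure d A).
Proof. by move=> [r r0 h]; exists r => //; exact: dclosure_sub (@CrC_closed r) h. Qed.

Lemma bO_dclosure {A} : baway A -> bO (dclosure d A).
Proof. by move=> h; split; [exact: dborel_closed (@dclosure_closed _)|exact: baway_dclosure]. Qed.

Lemma bO_dboundary {A} : baway A -> bO (dboundary d A).
Proof.
move=> h; apply: (bO_sub _ _ (bO_dclosure h)); last exact: subDsetl.
exact: dborel_closed (@dboundary_closed _).
Qed.

(** * Measures in M_O and their distance *)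

Implicit Types (m : MO d C) (A B : set S).

Let SB := g_sigma_algebraType (dopen d).

(* [isMO] constrains [mu] only on subsets of the complement of [C]; removing [C]
   turns it into a measure on all Borel sets. *)
Definition mO_fun m (A : set SB) : \bar R := proj1_sig m (A `\` C).

Lemma BorelO_setDC {A} : dborel d A -> BorelO d C (A `\` C).
Proof.
by move=> bA; split; [exact: dborelD (bA) (dborel_closed Cc)|move=> x []].
Qed.

Lemma mO_fun0 m : mO_fun m set0 = 0%E.
Proof. by rewrite /mO_fun set0D; case: m => mu []. Qed.

Lemma mO_fun_ge0 m A : (0 <= mO_fun m A)%E.
Proof.
rewrite /mO_fun; case: m => mu [/= h1 h2 _ _ _].
by have [/h2//|/h1 ->] := pselect (BorelO d C (A `\` C)).
Qed.

Lemma mO_fun_sigma_additive m : semi_sigma_additive (mO_fun m).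
Proof.
move=> F mF tF mUF; rewrite /mO_fun setD_bigcupl.
case: m => mu [/= _ _ _ h _]; apply: h; first by move=> n; exact: BorelO_setDC (mF n).
exact: trivIset_setIr tF.
Qed.

HB.instance Definition _ m := isMeasure.Build _ SB R (mO_fun m)
  (mO_fun0 m) (mO_fun_ge0 m) (@mO_fun_sigma_additive m).

Definition mO m : {measure set SB -> \bar R} := mO_fun m.

Lemma mOE m {A} : A `<=` ~` C -> mO m A = proj1_sig m A.
Proof. by move=> h; rewrite /mO/= /mO_fun setDE (setIidl h). Qed.

Lemma mO_le m {A B} : dborel d A -> dborel d B -> A `<=` B -> (mO m A <= mO m B)%E.
Proof. by move=> bA bB AB; apply: le_measure => //; rewrite inE; [exact: bA|exact: bB]. Qed.

Definition mass m A : R := fine (proj1_sig m A).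

Lemma bO_fin m {A} : bO A -> (mO m A < +oo)%E.
Proof.
move=> [bA [r r0 Ar]]; apply: (@le_lt_trans _ _ (mO m (~` Cr d C r))).
  exact: mO_le bA (bO_CrC  r0).1 Ar.
rewrite mOE; last exact: CrC_subC  r0.
by case: m => mu [/= _ _ _ _]; apply.
Qed.

Lemma massE m {A} : bO A -> mO m A = (mass m A)%:E.
Proof.
move=> bA; have := bO_fin m bA; rewrite /mass -mOE; last by case: (bO_BorelO  bA).
by move=> h; rewrite fineK// ge0_fin_numE.
Qed.

Lemma massE' m A : bO A -> proj1_sig m A = (mass m A)%:E.
Proof. by move=> bA; rewrite -massE// mOE//; case: (bO_BorelO  bA). Qed.

Lemma mass_ge0 m A : 0 <= mass m A.
Proof.
rewrite /mass; apply: fine_ge0; case: m => mu [/= h1 h2 _ _ _].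
by have [/h2//|/h1 ->] := pselect (BorelO d C A).
Qed.

Lemma mass0 m : mass m set0 = 0.
Proof. by rewrite /mass; case: m => mu [/= _ _ -> _ _]. Qed.

Lemma mass_le m {A B} : dborel d A -> bO B -> A `<=` B -> mass m A <= mass m B.
Proof.
move=> bA bB AB; rewrite -lee_fin -!massE//; last exact: bO_sub bB.
exact: mO_le bA bB.1 AB.
Qed.

Lemma massDU m {A B} : bO A -> bO B -> A `&` B = set0 ->
  mass m (A `|` B) = mass m A + mass m B.
Proof.
move=> bA bB AB; apply: EFin_inj; rewrite EFinD -!massE//; last exact: bOU.
exact: (@measureU _ R SB (mO m) A B bA.1 bB.1 AB).
Qed.

Lemma massD m {A B} : bO A -> dborel d B -> B `<=` A ->
  mass m (A `\` B) = mass m A - mass m B.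
Proof.
move=> bA bB BA; have b : bO B by exact: bO_sub bA.
have bAB : bO (A `\` B) by exact: bOD.
have : mass m (B `|` A `\` B) = mass m B + mass m (A `\` B) by apply: massDU => //; rewrite setDIK.
by rewrite setDUK//; lra.
Qed.

Lemma massU m {A B} : bO A -> bO B -> mass m (A `|` B) <= mass m A + mass m B.
Proof.
move=> bA bB; have bBA : bO (B `\` A) by apply: bOD => //; case: bA.
have -> : A `|` B = A `|` (B `\` A).
  by apply/seteqP; split => x; have [] := pselect (A x); rewrite /setD/setU/=; tauto.
rewrite massDU//; last by rewrite setDIK.
rewrite lerD2l; exact: mass_le (bBA.1) bB (@subDsetl _ _ _).
Qed.

Lemma mass_cvg_up m {F : nat -> set S} : bO (\bigcup_n F n) ->
  (forall n, dborel d (F n)) -> nondecreasing_seq F ->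
  mass m (F n) @[n --> \oo] --> mass m (\bigcup_n F n).
Proof.
move=> bU bF ndF.
have := @nondecreasing_cvg_mu _ SB R (mO m) F bF bU.1 ndF.
rewrite massE// (_ : _ \o _ = EFin \o (fun n => mass m (F n))); first by move/fine_cvg; rewrite /=.
apply/funext => n /=; apply: massE; apply: bO_sub bU => //.
exact: bigcup_sup.
Qed.

Lemma mass_cvg_dn m {F : nat -> set S} : bO (F 0%N) ->
  (forall n, dborel d (F n)) -> nonincreasing_seq F ->
  mass m (F n) @[n --> \oo] --> mass m (\bigcap_n F n).
Proof.
move=> b0 bF niF.
have bI : bO (\bigcap_n F n).
  by apply: bO_sub b0; [exact: (@bigcapT_measurable _ SB)|exact: bigcap_inf].
have := @nonincreasing_cvg_mu _ SB R (mO m) F (bO_fin m b0) bF bI.1 niF.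
rewrite massE// (_ : _ \o _ = EFin \o (fun n => mass m (F n))); first by move/fine_cvg; rewrite /=.
apply/funext => n /=; apply: massE; apply: bO_sub b0 => //.
by apply/subsetPset/niF.
Qed.

(** * Prohorov inequalities and the integral over radii *)

Implicit Types n : MO d C.

Definition dM_integrand m n (r : R) : R :=
  expR (- r) * (prohorov_r d C (proj1_sig m) (proj1_sig n) r /
    (1 + prohorov_r d C (proj1_sig m) (proj1_sig n) r)).

Lemma nbhd_setE F e : nbhd_set d F e = [set x | exists2 y, F y & d x y < e].
Proof. by apply/seteqP; split => x /dist_lt. Qed.

Lemma nbhd_set_open F e : dopen d (nbhd_set d F e).
Proof.
rewrite nbhd_setE => x [y Fy xy]; exists (e - d x y); first by rewrite subr_gt0.
move=> z /= xz; exists y => //; rewrite /dball/= in xz.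
by have := d_tri x z y; rewrite (d_sym z x); lra.
Qed.

Lemma bO_nbhd {r} F e : 0 < r -> bO (nbhd_set d F e `&` ~` Cr d C r).
Proof.
move=> r0; rewrite setIC; apply: bOI; first exact: bO_CrC.
exact: dborel_open (@nbhd_set_open F e).
Qed.

Lemma bO_closed {F r} : 0 < r -> dclosed d F -> F `<=` ~` Cr d C r -> bO F.
Proof. by move=> r0 cF Fr; split; [exact: dborel_closed|exists r]. Qed.

Lemma prohorov_ge0 (mu nu : set S -> \bar R) r : 0 <= prohorov_r d C mu nu r.
Proof.
rewrite /prohorov_r; set E := [set e | _].
have [->|/set0P E0] := eqVneq E set0; first by rewrite inf0.
by apply: lb_le_inf => // e [/ltW].
Qed.

Lemma prohorov_le {m n r e} : 0 < r -> 0 < e ->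
  (forall F, dclosed d F -> F `<=` ~` Cr d C r ->
     mass m F <= mass n (nbhd_set d F e `&` ~` Cr d C r) + e /\
     mass n F <= mass m (nbhd_set d F e `&` ~` Cr d C r) + e) ->
  prohorov_r d C (proj1_sig m) (proj1_sig n) r <= e.
Proof.
move=> r0 e0 h; apply: ge_inf; first by exists 0 => x [/ltW].
split => // F cF Fr; have bF := bO_closed r0 cF Fr.
rewrite !massE'//; try exact: bO_nbhd.
by rewrite -!EFinD !lee_fin; exact: h.
Qed.

Lemma prohorov_lt {m n r e} : 0 < r ->
  prohorov_r d C (proj1_sig m) (proj1_sig n) r < e ->
  forall F, dclosed d F -> F `<=` ~` Cr d C r ->
     mass m F <= mass n (nbhd_set d F e `&` ~` Cr d C r) + e /\
     mass n F <= mass m (nbhd_set d F e `&` ~` Cr d C r) + e.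
Proof.
move=> r0 /inf_lt he F cF Fr.
have {}he := he _.
have [|f [f0 fP] fe] := he.
  (* An empty set would have infimum 0, so a witness is required: the two total masses on [K] plus 1
     satisfy both inequalities trivially. *)
  set K := ~` Cr d C r.
  have Kge m' : 0 <= mass m' K by exact: mass_ge0.
  exists (mass m K + mass n K + 1); split; first by have := Kge m; have := Kge n; lra.
  move=> G cG Gr; have bG := bO_closed r0 cG Gr.
  rewrite !massE'//; try exact: bO_nbhd.
  rewrite -!EFinD !lee_fin.
  have := mass_le m bG.1 (bO_CrC r0) Gr; have := mass_le n bG.1 (bO_CrC r0) Gr.
  rewrite -/K.
  have := mass_ge0 m (nbhd_set d G (mass m K + mass n K + 1) `&` K).
  have := mass_ge0 n (nbhd_set d G (mass m K + mass n K + 1) `&` K).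
  by have := Kge m; have := Kge n; split; lra.
have bF := bO_closed r0 cF Fr.
have [] := fP F cF Fr; rewrite !massE'//; try exact: bO_nbhd.
rewrite -!EFinD !lee_fin.
have sub m' : mass m' (nbhd_set d F f `&` ~` Cr d C r) <= mass m' (nbhd_set d F e `&` ~` Cr d C r).
  apply: mass_le; [exact: (bO_nbhd _ _ r0).1|exact: bO_nbhd|].
  apply: setSI; rewrite !nbhd_setE => x [y Fy xy]; exists y => //; exact: lt_trans fe.
by have := sub m; have := sub n; split; lra.
Qed.

Lemma dM_integrand_ge0 m n r : 0 <= dM_integrand m n r.
Proof.
have := prohorov_ge0 (proj1_sig m) (proj1_sig n) r => p0.
by rewrite mulr_ge0 ?expR_ge0// divr_ge0// addr_ge0.
Qed.

Lemma dM_integrand_le m n r : dM_integrand m n r <= expR (- r).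
Proof.
have p0 := prohorov_ge0 (proj1_sig m) (proj1_sig n) r.
rewrite /dM_integrand -[leRHS]mulr1 ler_wpM2l ?expR_ge0//.
by rewrite ler_pdivrMr ?mul1r; lra.
Qed.

(** Extension by 0 to the whole line, where the density [exponential_pdf 1] dominates. *)
Definition dM_integrand_pos m n := (dM_integrand m n) \_ `]0, +oo[.

Lemma dM_integrand_pos_ge0 m n r : 0 <= dM_integrand_pos m n r.
Proof. by rewrite /dM_integrand_pos patchE; case: ifP => // _; exact: dM_integrand_ge0. Qed.

Lemma dM_integrand_pos_le m n r : dM_integrand_pos m n r <= exponential_pdf 1 r.
Proof.
rewrite /dM_integrand_pos patchE; case: ifPn => [|_]; last exact: exponential_pdf_ge0.
rewrite inE/= in_itv/= andbT => r0; rewrite (exponential_pdfE _ (ltW r0)) mul1r mulN1r.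
exact: dM_integrand_le.
Qed.

Lemma dMOE m n : dMO m n = fine (\int[@lebesgue_measure R]_r (dM_integrand_pos m n r)%:E).
Proof.
by rewrite /dMO /dM_fun integral_mkcond restrict_EFin.
Qed.

Lemma dMO_fin m n : (\int[@lebesgue_measure R]_r (dM_integrand_pos m n r)%:E)%E \is a fin_num.
Proof.
rewrite ge0_fin_numE; last by apply: integral_ge0 => r _; rewrite lee_fin dM_integrand_pos_ge0.
apply: (@le_lt_trans _ _ (\int[@lebesgue_measure R]_r (exponential_pdf 1 r)%:E)%E).
  by apply: le_lower_integral => r; rewrite lee_fin ?dM_integrand_pos_ge0 ?dM_integrand_pos_le.
by rewrite integral_exponential_pdf ?ltry.
Qed.

(** If the Prohorov distance were at least [e] at all radii in []0, r0[], the integrand would be at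
    least [c] there, as [x / (1 + x)] increases and [expR (- r)] decreases; the integral would then
    be at least [c * r0]. *)
Lemma dMO_lt_prohorov {e r0} : 0 < e -> 0 < r0 ->
  exists2 dl, 0 < dl & forall m n : MO d C, dMO m n < dl ->
    exists r, [/\ 0 < r, r < r0 & prohorov_r d C (proj1_sig m) (proj1_sig n) r < e].
Proof.
move=> e0 r00; pose c := expR (- r0) * (e / (1 + e)).
have c0 : 0 < c by rewrite mulr_gt0 ?expR_gt0// divr_gt0 ?addr_gt0.
exists (c * r0); first exact: mulr_gt0.
move=> m n; apply: contraPP => h.
apply/negP; rewrite -leNgt dMOE -lee_fin fineK ?dMO_fin//.
have -> : (c * r0)%:E = (\int[@lebesgue_measure R]_r ((cst c%:E) \_ `]0%R, r0[%classic) r)%E.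
  rewrite -integral_mkcond integral_cst//=.
  by rewrite lebesgue_measure_itv/= lte_fin r00 -EFinD subr0.
apply: le_lower_integral => r; first by rewrite patchE; case: ifP => // _; rewrite lee_fin ltW.
rewrite patchE; case: ifPn => [|_]; last by rewrite lee_fin dM_integrand_pos_ge0.
rewrite inE/= in_itv/= => /andP[rgt0 rr0].
rewrite lee_fin /dM_integrand_pos patchE ifT; last by rewrite inE/= in_itv/= rgt0.
set p := prohorov_r d C (proj1_sig m) (proj1_sig n) r.
have ep : e <= p by rewrite leNgt; apply/negP => pe; apply: h; exists r.
rewrite /dM_integrand -/p; apply: ler_pM; rewrite ?expR_ge0//.
- by rewrite divr_ge0 ?addr_ge0 ?ltW.
- by rewrite ler_expR lerN2 ltW.
- rewrite ler_pdivrMr; last by rewrite addr_gt0.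
  by rewrite mulrAC ler_pdivlMr; lra.
Qed.

(** * Continuous functionals approximating masses *)

(* A Ky Fan type functional: it inherits continuity directly from the Prohorov
   inequalities, so no integral against [m] is needed. *)
Definition ky_fan_set (phi : S -> R) (th : R -> R) m : set R :=
  [set t | 0 <= t /\ mass m [set x | th t < phi x] <= t].

Definition ky_fan phi th m : R := inf (ky_fan_set phi th m).

Section KyFan.
Context {phi : S -> R} {th : R -> R} {r0 : R}.
Hypotheses (phil : lip1 phi) (r00 : 0 < r0).
Hypothesis th_mono : forall u v, 0 <= u -> u <= v -> th u <= th v.
Hypothesis th_gap : forall T dl, 0 < dl -> exists2 e, 0 < e &
  forall u, 0 <= u -> u <= T -> th u + e <= th (u + dl).
Hypothesis th0 : [set x | th 0 < phi x] `<=` ~` Cr d C r0.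

Let E t := [set x | th t < phi x].

Let E_sub {s t} : 0 <= s -> s <= t -> E t `<=` E s.
Proof. by move=> s0 st x /=; apply: le_lt_trans; exact: th_mono. Qed.

Let bE t : dborel d (E t).
Proof. exact: dborel_open (dopen_gt _ phil). Qed.

Let bOE {t} : 0 <= t -> bO (E t).
Proof.
move=> t0; split; first exact: bE.
by exists r0 => //; apply: subset_trans th0; exact: E_sub.
Qed.

Let ky_fan_set_up {m s t} : ky_fan_set phi th m s -> s <= t -> ky_fan_set phi th m t.
Proof.
move=> [s0 Es] st; split; first exact: le_trans st.
apply: (le_trans _ st); apply: le_trans Es.
exact: mass_le (bE t) (bOE s0) (E_sub s0 st).
Qed.

Let ky_fan_set_neq0 m : ky_fan_set phi th m !=set0.
Proof.
exists (mass m (E 0)); split; first exact: mass_ge0.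
exact: mass_le (bE _) (bOE (lexx _)) (E_sub (lexx _) (mass_ge0 _ _)).
Qed.

Let ky_fan_set_lb m : has_lbound (ky_fan_set phi th m).
Proof. by exists 0 => t []. Qed.

Let ky_fan_le {m t} : ky_fan_set phi th m t -> ky_fan phi th m <= t.
Proof. by move=> mt; apply: ge_inf. Qed.

Let ky_fan_lt {m t} : ky_fan phi th m < t -> ky_fan_set phi th m t.
Proof. by move=> /(inf_lt (ky_fan_set_neq0 m))[s ms /ltW]; exact: ky_fan_set_up. Qed.

Let ky_fan_ge0 m : 0 <= ky_fan phi th m.
Proof. by apply: lb_le_inf => // t []. Qed.

(** Raising the level from [u] to [u + eps / 2] pays for both errors in the Prohorov inequality: the
    threshold rises by at least [e], which absorbs the [e]-enlargement because [phi] is 1-Lipschitz,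
    and the bound on the mass rises by [eps / 2], which absorbs the additive [e]. The rise of the
    threshold is uniform only for bounded [u], whence [T]. *)
Lemma ky_fan_continuous : dMcontinuous (@ky_fan phi th).
Proof.
move=> m eps eps0; set T := ky_fan phi th m + eps.
have e2 : 0 < eps / 2 by rewrite divr_gt0.
have [e' e'0 gap'] := th_gap T _ e2.
pose e := Num.min e' (eps / 2).
have e0 : 0 < e by rewrite lt_min e'0 e2.
have gap u : 0 <= u -> u <= T -> th u + e <= th (u + eps / 2).
  by move=> u0 uT; apply: le_trans (gap' _ u0 uT); rewrite lerD2l ge_min lexx.
have [dl dl0 hdl] := dMO_lt_prohorov e0 r00.
exists dl => // n /hdl[r [rgt0 rr0 /(prohorov_lt rgt0) hp]].
have step (m1 m2 : MO d C) : (forall F, dclosed d F -> F `<=` ~` Cr d C r ->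
    mass m1 F <= mass m2 (nbhd_set d F e `&` ~` Cr d C r) + e) ->
    forall u, u <= T -> ky_fan_set phi th m2 u -> ky_fan_set phi th m1 (u + eps / 2).
  move=> h u uT [u0 Eu]; split; first by rewrite addr_ge0// ltW.
  pose F := [set x | th u + e <= phi x].
  have cF : dclosed d F by exact: dclosed_ge.
  have F0 : F `<=` E 0.
    move=> x; rewrite /F/E/=; apply: lt_le_trans.
    by rewrite (le_lt_trans (th_mono _ _ (lexx _) u0))// ltrDl.
  have Fr0 : F `<=` ~` Cr d C r0 by exact: subset_trans th0.
  have Fr : F `<=` ~` Cr d C r by apply: subset_trans Fr0 (CrC_sub (ltW rr0)).
  have bF := bO_closed r00 cF Fr0.
  have EF : E (u + eps / 2) `<=` F.
    by move=> x; rewrite /F/E/= => /ltW; apply: le_trans; exact: gap.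
  apply: (@le_trans _ _ (mass m1 F)).
    exact: mass_le (bE _) bF EF.
  apply: (le_trans (h F cF Fr)); apply: lerD; last by rewrite ge_min lexx orbT.
  apply: le_trans Eu; apply: mass_le (bO_nbhd _ _ rgt0).1 (bOE u0) _.
  move=> x []; rewrite nbhd_setE => -[y Fy xy] _ /=.
  by have := phil y x; rewrite d_sym /E/=; move: Fy xy; rewrite /F/=; lra.
have m_n : ky_fan_set phi th n (ky_fan phi th m + eps / 4 + eps / 2).
  apply: (step n m) => [F cF Fr| |]; first by have [] := hp F cF Fr.
    by rewrite /T; lra.
  by apply: ky_fan_lt; lra.
have /ky_fan_le := m_n => lnm.
have [lmn|lmn] := ltP (ky_fan phi th m) (ky_fan phi th n + eps).
  by rewrite ltr_norml; lra.
have : ky_fan_set phi th m (ky_fan phi th n + eps / 4 + eps / 2).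
  apply: (step m n) => [F cF Fr| |]; first by have [] := hp F cF Fr.
    by rewrite /T; lra.
  by apply: ky_fan_lt; lra.
by move=> /ky_fan_le; lra.
Qed.

Lemma ky_fan_le_mass {m B} : bO B -> (forall t, 0 <= t -> E t `<=` B) -> ky_fan phi th m <= mass m B.
Proof.
move=> bB EB; apply: ky_fan_le; split; first exact: mass_ge0.
have b0 := mass_ge0 m B.
exact: mass_le (bE _) bB (EB _ b0).
Qed.

Lemma ky_fan_ge_mass {m B} : dborel d B -> (forall t, 0 <= t -> B `<=` E t) -> mass m B <= ky_fan phi th m.
Proof.
move=> bB EB; apply: lb_le_inf => // t [t0 Et]; apply: le_trans Et.
exact: mass_le bB (bOE t0) (EB _ t0).
Qed.

Lemma ky_fan_gt {m t} : t < mass m (E t) -> t <= ky_fan phi th m.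
Proof.
move=> h; have [t0|t0] := leP 0 t; last exact: le_trans (ltW t0) (ky_fan_ge0 m).
rewrite leNgt; apply/negP => /ky_fan_lt[_].
by rewrite leNgt h.
Qed.

Lemma ky_fan_lt_mass {m t} : 0 <= t -> mass m (E t) < t -> ky_fan phi th m <= t.
Proof. by move=> t0 /ltW h; apply: ky_fan_le. Qed.

End KyFan.

(** The thresholds [t / (j + 1)] are nonnegative, so the sets they cut out stay inside [G], and for
    fixed [t] these sets fill [G] as [j] grows. Once the set at level [t] has mass above [t], the
    functional is at least [t]; this happens eventually for every [t] below [mass m G]. *)
Lemma lower_approx {G} : dopen d G -> bO G ->
  exists u : nat -> MO d C -> R,
  [/\ forall j, dMcontinuous (u j),
      forall j m, u j m <= mass m G &
      forall m, u j m @[j --> \oo] --> mass m G].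
Proof.
move=> oG bG; have [r r0 Gr] := bG.2.
have CG : C `<=` ~` G by move=> x Cx Gx; exact: (CrC_subC r0 _ (Gr _ Gx)).
have nG0 : ~` G !=set0 by case: C0 => c Cc'; exists c; exact: CG.
have cnG : dclosed d (~` G) by rewrite /dclosed setCK.
pose phi := distR (~` G).
have phil : lip1 phi by exact: lip1_distR.
pose th (j : nat) (t : R) := t / j.+1%:R.
have j0 (j : nat) : 0 < j.+1%:R :> R by [].
have phiG x t : 0 <= t -> t < phi x -> G x.
  move=> t0 tx; apply: contrapT => nGx; move: tx; rewrite /phi distR_eq0//.
  by rewrite ltNge t0.
have mono j u v : 0 <= u -> u <= v -> th j u <= th j v.
  by move=> _ uv; rewrite /th ler_wpM2r// invr_ge0.
have gap j : forall T dl, 0 < dl -> exists2 e, 0 < e &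
    forall u, 0 <= u -> u <= T -> th j u + e <= th j (u + dl).
  move=> T dl dl0; exists (dl / j.+1%:R); first by rewrite divr_gt0.
  by move=> u _ _; rewrite /th mulrDl.
have EG j t : 0 <= t -> [set x | th j t < phi x] `<=` G.
  by move=> t0 x /=; apply: phiG; rewrite /th divr_ge0.
have E0 j : [set x | th j 0 < phi x] `<=` ~` Cr d C r.
  by apply: subset_trans Gr; exact: EG.
exists (fun j => ky_fan phi (th j)); split.
- by move=> j; exact: (ky_fan_continuous phil r0 (mono j) (gap j) (E0 j)).
- by move=> j m; apply: (ky_fan_le_mass phil) => //; exact: EG.
move=> m; apply/cvgrPdist_le => eps eps0.
have le_up j : ky_fan phi (th j) m <= mass m G.
  by apply: (ky_fan_le_mass phil) => //; exact: EG.
pose t := mass m G - eps.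
suff : \forall j \near \oo, t <= ky_fan phi (th j) m.
  apply: filterS => j; rewrite /t => h; rewrite ger0_norm ?subr_ge0//; lra.
have [t0|t0] := leP 0 t; last first.
  apply: nearW => j; apply: (ky_fan_gt phil r0 (mono j) (E0 j)).
  exact: lt_le_trans t0 (mass_ge0 _ _).
have UG : \bigcup_j [set x | th j t < phi x] = G.
  apply/seteqP; split => [x [j _]|x Gx]; first exact: EG.
  have px : 0 < phi x by apply: distR_gt0 => //; exact.
  exists (Num.bound (t / phi x)) => //=; rewrite /th ltr_pdivrMr//.
  rewrite mulrC -ltr_pdivrMr// (lt_trans (archi_boundP (divr_ge0 t0 (ltW px))))//.
  by rewrite ltr_nat.
have ndE : nondecreasing_seq (fun j => [set x | th j t < phi x]).
  move=> i j ij; apply/subsetPset => x /=; apply: le_lt_trans.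
  by rewrite /th ler_wpM2l// lef_pV2 ?posrE// ler_nat ltnS.
have := @mass_cvg_up m (fun j => [set x | th j t < phi x]).
rewrite UG => /(_ bG (fun j => dborel_open (dopen_gt _ phil)) ndE).
move=> /cvgr_gt /(_ t); rewrite /t ltrBlDr ltrDl => /(_ eps0).
by apply: filterS => j; exact: (ky_fan_gt phil r0 (mono j) (E0 j)).
Qed.

(** The thresholds must increase in [t] for [th_gap] and yet stay negative for all [t], so that
    every set cut out contains [F]; this dictates the form [- r / ((j + 1) * (1 + t))]. For fixed
    [t] the sets are neighbourhoods of [F] shrinking to [F]. *)
Lemma upper_approx {F} : dclosed d F -> bO F ->
  exists u : nat -> MO d C -> R,
  [/\ forall j, dMcontinuous (u j),
      forall j m, mass m F <= u j m &
      forall m, u j m @[j --> \oo] --> mass m F].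
Proof.
move=> cF bF; have [->|/set0P F0] := eqVneq F set0.
  exists (fun _ _ => 0); split.
  - by move=> _ m e e0; exists 1 => // n _; rewrite subrr normr0.
  - by move=> _ m; rewrite mass0.
  - by move=> m; rewrite mass0; exact: cvg_cst.
have [s s0 Fs] := bF.2.
(* Half of [s]: points within [r] of [F] are still at distance at least [r] from [C]. *)
have [r r0 sr] : exists2 r, 0 < r & s = r + r by exists (s / 2); lra.
pose phi x := - distR F x.
have phil : lip1 phi by exact/lip1N/lip1_distR.
pose th (j : nat) (t : R) := - (r / (j.+1%:R * (1 + t))).
have j0 (j : nat) : 0 < j.+1%:R :> R by [].
have den j t : 0 <= t -> 0 < j.+1%:R * (1 + t).
  by move=> t0; rewrite mulr_gt0// ltr_pwDl.
have thlt0 j t : 0 <= t -> th j t < 0.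
  by move=> t0; rewrite /th oppr_lt0 divr_gt0// den.
have mono j u v : 0 <= u -> u <= v -> th j u <= th j v.
  move=> u0 uv; rewrite /th lerN2 ler_pM2l// lef_pV2 ?posrE ?den//; last exact: le_trans uv.
  by rewrite ler_pM2l// lerD2l.
have gap j : forall T dl, 0 < dl -> exists2 e, 0 < e &
    forall u, 0 <= u -> u <= T -> th j u + e <= th j (u + dl).
  move=> T dl dl0; have [T0|T0] := ltP T 0.
    by exists 1 => // u u0 /(le_trans u0); rewrite leNgt T0.
  (* The increment of [th j] from [T] to [T + dl], the smallest one over [u <= T]. *)
  exists (r * dl / (j.+1%:R * (1 + T) * (1 + (T + dl)))).
    by rewrite divr_gt0 ?mulr_gt0 ?den//; lra.
  move=> u u0 uT.
  rewrite (_ : th j (u + dl) = th j u + r * dl / (j.+1%:R * (1 + u) * (1 + (u + dl)))); last first.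
    rewrite /th; field; rewrite nat1r pnatr_eq0/=; apply/andP; split; lra.
  have pu : 0 < j.+1%:R * (1 + u) * (1 + (u + dl)) by rewrite mulr_gt0 ?den//; lra.
  have pT : 0 < j.+1%:R * (1 + T) * (1 + (T + dl)) by rewrite mulr_gt0 ?den//; lra.
  rewrite lerD2l ler_pM2l ?mulr_gt0// lef_pV2 ?posrE//.
  have pu1 : 0 <= j.+1%:R * (1 + u) by rewrite ltW ?den.
  apply: ler_pM => //; [lra|by rewrite ler_pM2l//; lra|lra].
have FE j t : 0 <= t -> F `<=` [set x | th j t < phi x].
  by move=> t0 x Fx /=; rewrite /phi distR_eq0// oppr0 thlt0.
have E0 j : [set x | th j 0 < phi x] `<=` ~` Cr d C r.
  rewrite CrCE => x /=; rewrite /th /phi ltrN2 => /(distR_lt _ _ F0)[y Fy xy].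
  have := Fs _ Fy; rewrite CrCE/= => sy.
  have := lip1_distR C0 y x; rewrite d_sym.
  have : r / (j.+1%:R * (1 + 0)) <= r.
    rewrite addr0 mulr1 ler_pdivrMr// ler_peMr ?(ltW r0)//.
    by rewrite ler1n.
  by set q := r / _ in xy *; lra.
have ge_dn j m : mass m F <= ky_fan phi (th j) m.
  by apply: (ky_fan_ge_mass phil r0 (mono j) (E0 j)) => //; [exact: bF.1|exact: FE].
exists (fun j => ky_fan phi (th j)); split => //.
  by move=> j; exact: (ky_fan_continuous phil r0 (mono j) (gap j) (E0 j)).
move=> m; apply/cvgrPdist_le => eps eps0.
pose t := mass m F + eps.
have t0 : 0 <= t by rewrite addr_ge0 ?mass_ge0// ltW.
suff : \forall j \near \oo, ky_fan phi (th j) m <= t.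
  by apply: filterS => j; rewrite /t => h; rewrite distrC ger0_norm ?subr_ge0//; lra.
have UF : \bigcap_j [set x | th j t < phi x] = F.
  apply/seteqP; split => [x hx|x Fx j _]; last exact: FE.
  apply: contrapT => nFx.
  have px : 0 < distR F x by apply: distR_gt0.
  have := hx (Num.bound (r / distR F x)) I; rewrite /th/phi/= ltrN2.
  apply/negP; rewrite -leNgt ler_pdivrMr ?den//.
  rewrite mulrC -ler_pdivrMr//.
  have h1 := ltW (archi_boundP (divr_ge0 (ltW r0) (ltW px))).
  apply: (le_trans h1); apply: (@le_trans _ _ (Num.bound (r / distR F x)).+1%:R).
    by rewrite ler_nat.
  by rewrite ler_peMr//; lra.
have niE : nonincreasing_seq (fun j => [set x | th j t < phi x]).
  move=> i j ij; apply/subsetPset => x /=; apply: le_lt_trans.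
  rewrite /th lerN2 ler_pM2l// lef_pV2 ?posrE ?den//.
  by rewrite ler_pM2r ?ler_nat ?ltnS//; lra.
have bE j : dborel d [set x | th j t < phi x] by exact: dborel_open (dopen_gt _ phil).
have bE0 : bO [set x | th 0%N t < phi x].
  split => //; exists r => //; apply: subset_trans (E0 0%N).
  by move=> x /=; apply: le_lt_trans; exact: mono.
have := @mass_cvg_dn m (fun j => [set x | th j t < phi x]) bE0 bE niE.
rewrite UF => /cvgr_lt /(_ t); rewrite /t ltrDl => /(_ eps0).
by apply: filterS => j; exact: ky_fan_lt_mass.
Qed.

(** * Measurability of masses and null level sets *)

Lemma dMcontinuous_measurable {f : MO d C -> R} : dMcontinuous f ->
  measurable_fun setT (f : MOB d C -> R).
Proof.
move=> cf mD; apply: (measurability _ (RGenOInfty.measurableE R)) => //.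
move=> _ [_ [a ->] <-]; rewrite setTI; apply: sub_sigma_algebra => m /=.
rewrite in_itv/= andbT => am.
have e0 : 0 < f m - a by rewrite subr_gt0.
have [dl dl0 h] := cf m _ e0; exists dl => // n /h.
by rewrite in_itv/= andbT ltr_norml; lra.
Qed.

Lemma measurable_mass_open G : dopen d G -> bO G ->
  measurable_fun setT (fun m : MOB d C => mass m G).
Proof.
move=> oG bG; have [u [cu _ lu]] := lower_approx oG bG.
apply: (@measurable_fun_cvg _ _ _ setT (fun j (m : MOB d C) => u j m)).
  by move=> j; exact: dMcontinuous_measurable.
by move=> m _; exact: lu.
Qed.

(** Dynkin induction from open sets. Everything is intersected with one open [K] containing [A] and
    bounded away from [C], so that masses are finite and complements become differences. *)
Lemma measurable_mass {A} : bO A -> measurable_fun setT (fun m : MOB d C => mass m A).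
Proof.
move=> [bA [r r0 Ar]].
pose K := [set x | r / 2 < distR C x].
have oK : dopen d K by exact: dopen_gt (lip1_distR C0).
have bOK : bO K.
  split; [exact: dborel_open|exists (r / 2); first by lra].
  by rewrite CrCE => x /ltW.
have bK : dborel d K by exact: dborel_open.
have bOIK B : dborel d B -> bO (B `&` K) by move=> bB; rewrite setIC; exact: bOI.
have -> : A = A `&` K.
  rewrite setIidl// => x /Ar; rewrite CrCE /K/= => rx; lra.
pose P (A : set SB) := measurable_fun setT (fun m : MOB d C => mass m (A `&` K)).
apply: (@dynkin_induction _ SB (dopen d) P) => //.
- by move=> U V; exact: dopenI.
- by rewrite /P setTI; exact: measurable_mass_open.
- move=> U oU; apply: measurable_mass_open; first exact: dopenI.
  exact: bOIK (dborel_open oU).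
- move=> B mB mPB; rewrite /P.
  have -> : (fun m : MOB d C => mass m (~` B `&` K)) = (fun m => mass m K - mass m (B `&` K)).
    apply/funext => m; rewrite -(massD _ bOK (bOIK _ mB).1 (@subIsetr _ _ _)).
    by congr mass; rewrite setDIr setDv setU0 setDE setIC.
  by apply: measurable_funB => //; exact: measurable_mass_open.
move=> F mF tF mPF.
pose U k := (\bigcup_(i in `I_k) F i) `&` K.
have bU k : dborel d (\bigcup_(i in `I_k) F i).
  exact: (@bigcup_measurable _ SB).
have mU k : measurable_fun setT (fun m : MOB d C => mass m (U k)).
  elim: k => [|k IH].
    rewrite /U II0 bigcup_set0 set0I; under eq_fun do rewrite mass0.
    exact: measurable_cst.
  rewrite /U IIS bigcup_setU bigcup_set1 setIUl.
  have -> : (fun m : MOB d C => mass m (\bigcup_(i in `I_k) F i `&` K `|` F k `&` K)) =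
      (fun m => mass m (U k) + mass m (F k `&` K)).
    apply/funext => m; apply: massDU; [exact: bOIK|exact: bOIK (mF k)|].
    rewrite setIACA setIid; apply/seteqP; split => // x [[[i ik Fi] Fk] _].
    have /eqP := @tF i k I I (ex_intro _ x (conj Fi Fk)).
    by rewrite /= in ik; rewrite ltn_eqF.
  by apply: measurable_funD => //; exact: mPF.
apply: (@measurable_fun_cvg _ _ _ setT (fun k (m : MOB d C) => mass m (U k))) => // m _.
have UE : \bigcup_k U k = \bigcup_k F k `&` K.
  rewrite -setI_bigcupl; congr setI; apply/seteqP; split => x.
    by move=> [k _ [i ik Fi]]; exists i.
  by move=> [i _ Fi]; exists i.+1 => //; exists i => /=.
rewrite -UE; apply: mass_cvg_up.
- by rewrite UE; apply: bOIK; exact: (@bigcupT_measurable _ SB).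
- by move=> k; apply: dborelI.
- move=> i j ij; apply/subsetPset; apply: setSI; apply: bigcup_subset => k /=.
  by move=> /leq_trans; apply.
Qed.

Lemma dborel_level {phi : S -> R} {t} : lip1 phi -> dborel d [set x | phi x = t].
Proof.
move=> phil.
rewrite (_ : [set x | _] = [set x | t <= phi x] `\` [set x | t < phi x]).
  exact: dborelD (dborel_closed (dclosed_ge _ phil)) (dborel_open (dopen_gt _ phil)).
apply/seteqP; split => x /=; first by move=> ->; rewrite lexx ltxx.
by rewrite le_eqVlt => -[/orP[/eqP|]].
Qed.

Lemma sum_mass_levels_le m (phi : S -> R) K s : lip1 phi -> bO K -> uniq s ->
  (forall t, t \in s -> [set x | phi x = t] `<=` K) ->
  \sum_(t <- s) mass m [set x | phi x = t] <= mass m K.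
Proof.
move=> phil; elim: s K => [|t s IH] K bK /=; first by rewrite big_nil mass_ge0.
move=> /andP[ts us] sK; rewrite big_cons.
have tK : [set x | phi x = t] `<=` K by apply: sK; rewrite mem_head.
have bt : dborel d [set x | phi x = t] := dborel_level phil.
have : \sum_(u <- s) mass m [set x | phi x = u] <= mass m (K `\` [set x | phi x = t]).
  apply: IH => //; first exact: bOD.
  move=> u us' x xu; split; first by apply: (sK u) => //; rewrite inE us' orbT.
  by move=> /= xt; move: ts; rewrite -xt xu us'.
by rewrite massD//; lra.
Qed.

Lemma countable_levels m {phi : S -> R} {r} (D : set R) : lip1 phi -> 0 < r ->
  (forall t, D t -> [set x | phi x = t] `<=` ~` Cr d C r) ->
  countable [set t | D t /\ 0 < mass m [set x | phi x = t]].
Proof.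
move=> phil r0 DK.
apply: (@countable_sum_bounded_gt0 _ _ _ (mass m (~` Cr d C r))) => s us sD.
by apply: sum_mass_levels_le => //; [exact: bO_CrC|move=> t /sD/DK].
Qed.

Definition Pnull (P : probability (MOB d C) R) (A : set S) :=
  {ae P, forall m : MOB d C, mass m A = 0}.

Lemma PnullP P A : bO A -> Pnull P A <->
  P [set m : MOB d C | (0 < proj1_sig m A)%E] = 0%E.
Proof.
move=> bA.
have -> : [set m : MOB d C | (0 < proj1_sig m A)%E] = ~` [set m | mass m A = 0].
  apply/seteqP; split => m /=; rewrite massE'// lte_fin.
    by move=> + h; rewrite h ltxx.
  by move=> /eqP h; rewrite lt_neqAle eq_sym h mass_ge0.
rewrite /Pnull /almost_everywhere; apply: negligibleP.
apply: measurableC; rewrite -[X in measurable X]setTI.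
by have := measurable_mass bA measurableT _ (measurable_set1 (0 : R)).
Qed.

(** Distinct levels are disjoint subsets of [K], so their damped expected masses have bounded sums
    and only countably many are positive, while the interval is uncountable. As the damping factor
    never vanishes, a zero expectation makes the level itself almost surely null. *)
Lemma good_level P {phi : S -> R} {a b r} : lip1 phi -> 0 < r -> a < b ->
  [set x | a < phi x < b] `<=` ~` Cr d C r ->
  exists2 t, a < t < b & Pnull P [set x | phi x = t].
Proof.
move=> phil r0 ab abr; pose K := ~` Cr d C r.
have bK : bO K by exact: bO_CrC.
have tK t : a < t < b -> [set x | phi x = t] `<=` K.
  by move=> tab; apply: subset_trans abr => x /= ->.
have bL t (tab : a < t < b) := bO_sub (dborel_level phil) (tK t tab) bK.
(* the weight [expR (- mass m K)] makes the sums over [t] bounded by 1 *)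
pose g t (m : MOB d C) := mass m [set x | phi x = t] * expR (- mass m K).
have g0 t m : 0 <= g t m by rewrite mulr_ge0 ?mass_ge0 ?expR_ge0.
have mg t : a < t < b -> measurable_fun setT (fun m : MOB d C => (g t m)%:E).
  move=> tab; apply/measurable_EFinP; apply: measurable_funM.
    exact: measurable_mass (bL _ tab).
  apply: measurableT_comp => //; apply: measurableT_comp => //.
  exact: measurable_mass.
have sg s m : uniq s -> (forall t, t \in s -> a < t < b) -> \sum_(t <- s) g t m <= 1.
  move=> us sab; rewrite -big_distrl/= expRN -ler_pdivlMr ?invr_gt0 ?expR_gt0//.
  rewrite mul1r invrK; apply: (@le_trans _ _ (mass m K)).
    by apply: sum_mass_levels_le => // t /sab/tK.
  by apply: le_trans (expR_ge1Dx _); rewrite lerDr.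
have Ig s : uniq s -> (forall t, t \in s -> a < t < b) ->
    (\sum_(t <- s) \int[P]_m (g t m)%:E <= 1)%E.
  move=> us sab.
  have -> : (\sum_(t <- s) \int[P]_m (g t m)%:E = \int[P]_m (\sum_(t <- s) g t m)%:E)%E.
    elim: s us sab => [|t s IH] /= us sab.
      by rewrite big_nil; under eq_integral do rewrite big_nil; rewrite integral0.
    rewrite big_cons; under [RHS]eq_integral do rewrite big_cons EFinD.
    have sab' u : u \in s -> a < u < b by move=> us'; apply: sab; rewrite inE us' orbT.
    rewrite ge0_integralD//.
    - by rewrite IH//; case/andP: us.
    - by move=> m _; rewrite lee_fin.
    - by apply: mg; apply: sab; rewrite mem_head.
    - by move=> m _; rewrite lee_fin sumr_ge0.
    - apply/measurable_EFinP; elim: s sab' {IH us sab} => [|u s IH] sab'.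
        under eq_fun do rewrite big_nil; exact: measurable_cst.
      under eq_fun do rewrite big_cons; apply: measurable_funD.
        by apply/measurable_EFinP; exact: (mg u (sab' u (mem_head u s))).
      by apply: IH => v vs; apply: sab'; rewrite inE vs orbT.
  apply: (@le_trans _ _ (\int[P]_(m in setT) (cst 1 m))%E).
    apply: le_lower_integral => m; rewrite lee_fin ?sumr_ge0//.
    exact: sg.
  by rewrite integral_cst// mul1e; exact: (probability_le1 P measurableT).
have Ifin t : a < t < b -> (\int[P]_m (g t m)%:E)%E \is a fin_num.
  move=> tab; rewrite ge0_fin_numE; last by apply: integral_ge0 => m _; rewrite lee_fin.
  apply: (@le_lt_trans _ _ 1%E); last exact: ltry.
  have := Ig [:: t] isT; rewrite big_seq1; apply.
  by move=> u; rewrite inE => /eqP ->.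
pose w t := fine (\int[P]_m (g t m)%:E).
have cw : countable [set t | a < t < b /\ 0 < w t].
  apply: (@countable_sum_bounded_gt0 _ _ _ 1) => s us sab.
  rewrite -lee_fin; apply: le_trans (Ig s us sab).
  rewrite -sumEFin big_seq [leRHS]big_seq; apply: lee_sum => t ts.
  by rewrite fineK// Ifin// sab.
have [[t tab wt]|h] := pselect (exists2 t, a < t < b & w t = 0).
  exists t => //; rewrite /Pnull.
  have : (\int[P]_m `|(g t m)%:E| = 0)%E.
    under eq_integral do rewrite gee0_abs ?lee_fin//.
    by rewrite -[LHS]fineK ?Ifin// -/(w t) wt.
  move/(ae_eq_integral_abs P measurableT (mg t tab)); apply: filterS => m /(_ I)/= [].
  by move=> /eqP; rewrite mulf_eq0 [X in _ || X]gt_eqF ?expR_gt0// orbF => /eqP.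
exfalso.
have : countable (`]a, b[ : set R).
  apply: sub_countable cw; apply: subset_card_le => t /=; rewrite in_itv/= => tab.
  split => //; rewrite lt_neqAle eq_sym fine_ge0 ?andbT; last first.
    by apply: integral_ge0 => m _; rewrite lee_fin.
  by apply/eqP => wt; apply: h; exists t.
move/countable_lebesgue_measure0; rewrite lebesgue_measure_itv/= lte_fin ab.
by move=> /eqP; rewrite -EFinD eqe subr_eq0 gt_eqF.
Qed.

(** * A countable convergence-determining family of continuity sets *)

Implicit Types P : probability (MOB d C) R.

Lemma Pnull_sub {P A B} : dborel d A -> bO B -> A `<=` B -> Pnull P B -> Pnull P A.
Proof.
move=> bA bB AB; rewrite /Pnull; apply: filterS => m h.
by apply/eqP; rewrite eq_le mass_ge0 andbT -h; exact: mass_le.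
Qed.

Lemma PnullU {P A B} : bO A -> bO B -> Pnull P A -> Pnull P B -> Pnull P (A `|` B).
Proof.
move=> bA bB; rewrite /Pnull; apply: filterS2 => m hA hB.
by apply/eqP; rewrite eq_le mass_ge0 andbT (le_trans (massU m bA bB))// hA hB addr0.
Qed.

Lemma SPP P A : SP P A <-> bO A /\ Pnull P (dboundary d A).
Proof.
split.
  by move=> [[bA _] Aa PA]; split=> //; apply/PnullP => //; exact: bO_dboundary.
move=> [bA PA]; split; [exact: bO_BorelO|by case: bA|].
by apply/PnullP => //; apply: bO_dboundary; case: bA.
Qed.

Lemma SP0 P : SP P set0.
Proof.
apply/SPP; split; first exact: bO0.
apply: (Pnull_sub _ bO0); [exact: dborel_closed (dboundary_closed _)| |].
  by apply: dboundary_sub => //; rewrite /dclosed setC0 => x _; exists 1.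
by apply: aeW => m; exact: mass0.
Qed.

Lemma SPU {P A B} : SP P A -> SP P B -> SP P (A `|` B).
Proof.
move=> /SPP[bA PA] /SPP[bB PB]; apply/SPP; split; first exact: bOU.
have bbA := bO_dboundary bA.2; have bbB := bO_dboundary bB.2.
apply: (Pnull_sub _ (bOU bbA bbB) (@dboundaryU A B)).
  exact: dborel_closed (dboundary_closed _).
exact: PnullU.
Qed.

(** The boundary of the open set [{t < phi}] lies in the level set [{phi = t}]. *)
Lemma SP_gt {P} {phi : S -> R} {t r} : lip1 phi -> 0 < r ->
  [set x | t <= phi x] `<=` ~` Cr d C r -> Pnull P [set x | phi x = t] ->
  SP P [set x | t < phi x].
Proof.
move=> phil r0 sub nul; have bK := bO_CrC r0.
have oU : dopen d [set x | t < phi x] by exact: dopen_gt.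
apply/SPP; split.
  split; first exact: dborel_open.
  by exists r => //; apply: subset_trans sub => x /ltW.
apply: Pnull_sub nul; first exact: dborel_closed (dboundary_closed _).
  apply: (bO_sub (dborel_level phil) _ bK); apply: subset_trans sub.
  by move=> x /= ->.
move=> x [cx ix] /=; apply/eqP; rewrite eq_le; apply/andP; split.
  by rewrite leNgt; apply/negP => tx; apply: ix; exact: (dinterior_max oU (@subset_refl _ _) _ tx).
by apply: (dclosure_sub (dclosed_ge t phil) _ _ cx) => y /ltW.
Qed.

Hypothesis hsep : dseparable d.

Lemma dense_seq : exists u : nat -> S, forall x e, 0 < e -> exists a, d x (u a) < e.
Proof.
have [D /countable_injP[f finj] Dd] := hsep.
exists (fun a => xget point [set y | D y /\ f y = a]) => x e e0.
have [y Dy xy] := Dd x e e0; exists (f y).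
case: xgetP => [z _ [Dz fz]|/(_ y) h]; last by case: h.
by rewrite (_ : z = y)//; apply: finj; rewrite ?inE.
Qed.

(** The radius is left to [good_level], which finds a null sphere between the two prescribed radii.
    The condition on [y] keeps the larger ball at distance [1 / (b + 1)] from [C]; centres too close
    to [C] get the empty set as default. *)
Lemma basic_ball P y b : exists U, [/\ SP P U, dopen d U &
  2 / b.+1%:R < distR C y ->
    [set x | d y x < b.+2%:R^-1] `<=` U /\ U `<=` [set x | d y x < b.+1%:R^-1]].
Proof.
have b1 : 0 < b.+1%:R^-1 :> R by rewrite invr_gt0.
have b12 : b.+2%:R^-1 < b.+1%:R^-1 :> R by rewrite ltf_pV2 ?posrE// ltr_nat.
have [h|h] := ltP (2 / b.+1%:R) (distR C y); last first.
  by exists set0; split => //; exact: SP0.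
have phil : lip1 (fun x => - d y x) by exact/lip1N/lip1_d.
have sub t : - b.+1%:R^-1 <= t -> [set x | t <= - d y x] `<=` ~` Cr d C b.+1%:R^-1.
  rewrite CrCE => bt x /= tx.
  have := lip1_distR C0 y x; move: h bt tx; set q := b.+1%:R^-1; lra.
have ab : - b.+1%:R^-1 < - b.+2%:R^-1 :> R by rewrite ltrN2.
have sub' : [set x | - b.+1%:R^-1 < - d y x < - b.+2%:R^-1] `<=` ~` Cr d C b.+1%:R^-1.
  by move=> x /= /andP[/ltW h1 _]; exact: (sub _ (lexx _) x h1).
have [t /andP[t1 t2] nt] := good_level P phil b1 ab sub'.
exists [set x | t < - d y x]; split.
- exact: (SP_gt phil b1 (sub _ (ltW t1)) nt).
- exact: dopen_gt.
- by move=> _; move: t1 t2; set q := b.+1%:R^-1; set q2 := b.+2%:R^-1; split => x /=; lra.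
Qed.

Lemma outer_set P k : exists2 r, k.+2%:R^-1 < r < k.+1%:R^-1 & SP P [set x | r < distR C x].
Proof.
have k2 : 0 < k.+2%:R^-1 :> R by rewrite invr_gt0.
have k12 : k.+2%:R^-1 < k.+1%:R^-1 :> R by rewrite ltf_pV2 ?posrE// ltr_nat.
have sub : [set x | k.+2%:R^-1 < distR C x < k.+1%:R^-1] `<=` ~` Cr d C k.+2%:R^-1.
  by rewrite CrCE => x /= /andP[/ltW].
have [t tk nt] := good_level P (lip1_distR C0) k2 k12 sub.
exists t => //; apply: (SP_gt (lip1_distR C0) k2) => //.
by rewrite CrCE => x /=; apply: le_trans; case/andP: tk => /ltW.
Qed.

(** The second clause gives lower bounds on masses of open sets. The third puts a closed set inside
    an open [A i] whose mass converges, so that upper bounds on closed sets follow by taking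
    complements in [A i]. *)
Definition determining (A : nat -> set S) :=
  [/\ forall i, bO (A i),
   forall G, dopen d G -> G `<=` ~` C -> exists I : nat -> nat,
     nondecreasing_seq (A \o I) /\ \bigcup_k A (I k) = G &
   forall r, 0 < r -> exists i r', 0 < r' < r /\ A i = [set x | r' < distR C x]].

Lemma determining_SP P : exists2 A, determining A & forall i, SP P (A i).
Proof.
have [u hu] := dense_seq.
pose W (p : nat * nat) := projT1 (cid (basic_ball P (u p.1) p.2)).
have WSP p : SP P (W p) by have [] := projT2 (cid (basic_ball P (u p.1) p.2)).
have Wo p : dopen d (W p) by have [] := projT2 (cid (basic_ball P (u p.1) p.2)).
have WP p : 2 / p.2.+1%:R < distR C (u p.1) ->
    [set x | d (u p.1) x < p.2.+2%:R^-1] `<=` W p /\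
    W p `<=` [set x | d (u p.1) x < p.2.+1%:R^-1].
  by have [] := projT2 (cid (basic_ball P (u p.1) p.2)).
pose V k := [set x | projT1 (cid2 (outer_set P k)) < distR C x].
pose U (s : seq (nat * nat)) := \bigcup_(p in [set` s]) W p.
have USP s : SP P (U s).
  elim: s => [|p s IH].
    by rewrite (_ : U [::] = set0); [exact: SP0|apply/seteqP; split => // x []].
  rewrite (_ : U (p :: s) = W p `|` U s); first exact: SPU.
  apply/seteqP; split => x.
    by move=> [q]; rewrite /= inE => /predU1P[->|qs] qx; [left|right; exists q].
  by move=> [px|[q qs qx]]; [exists p => //=; exact: mem_head|exists q => //=; rewrite inE qs orbT].
(* A single enumeration: [inl] codes a finite union of balls, [inr] an outer set, and indices coding
   nothing give the empty set. *)
pose A i := match (unpickle i : option (seq (nat * nat) + nat)) with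
  | Some (inl s) => U s | Some (inr k) => V k | None => set0 end.
have ASP i : SP P (A i).
  rewrite /A; case: unpickle => [[s|k]|]; [exact: USP| |exact: SP0].
  by rewrite /V; case: cid2.
exists A => //; split; first by move=> i; have /SPP[] := ASP i.
  move=> G oG GC.
  (* The balls inside [G] with code below [k]: finitely many for each [k], increasing with [k], and
     all of them in the limit. *)
  pose s k := [seq p <- pmap (@pickle_inv (nat * nat)%type) (iota 0 k) | `[< W p `<=` G >]].
  have sP k p : p \in s k <-> W p `<=` G /\ (pickle p < k)%N.
    rewrite mem_filter mem_pmap; split.
      move=> /andP[/asboolP ? /mapP[i]]; rewrite mem_iota add0n => /= ik ip; split => //.
      by have := @pickle_invK (nat * nat)%type i; rewrite /oapp -ip => ->.
    move=> [/asboolP -> pk] /=; apply/mapP; exists (pickle p); last by rewrite pickleK_inv.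
    by rewrite mem_iota.
  exists (fun k => pickle (inl (s k) : seq (nat * nat) + nat)); split.
    move=> i j ij; apply/subsetPset; rewrite /A /= !pickleK.
    move=> x [p /= /sP[pG pi] px]; exists p => //=; apply/sP; split => //.
    exact: leq_trans ij.
  rewrite /A; under eq_bigcupr do rewrite pickleK.
  apply/seteqP; split => [x [k _ [p /= /sP[pG _] /pG]]//|x Gx].
  have [e e0 he] := oG x Gx.
  have eC : e <= distR C x.
    by rewrite leNgt; apply/negP => /(distR_lt _ _ C0)[y Cy /he/GC].
  (* With [4 / (b + 1) < e], a centre within [1 / (b + 2)] of [x] keeps distance more than
     [2 / (b + 1)] from [C], as [basic_ball] requires, and its ball stays within [e] of [x]. *)
  pose b := Num.bound (4 / e).
  have hb : 4 / b.+1%:R < e.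
    rewrite ltr_pdivrMr// -ltr_pdivrMl// mulrC.
    have : 0 <= 4 / e by rewrite divr_ge0// ltW.
    by move=> /archi_boundP/lt_trans; apply; rewrite ltr_nat.
  have b2 : 0 < b.+2%:R^-1 :> R by rewrite invr_gt0.
  have b12 : b.+2%:R^-1 < b.+1%:R^-1 :> R by rewrite ltf_pV2 ?posrE// ltr_nat.
  have [a ha] := hu x _ b2.
  have [|Wl Wr] := WP (a, b).
    have := lip1_distR C0 x (u a); move: hb ha b12 b2 => /=.
    by set q := b.+1%:R^-1; set q2 := b.+2%:R^-1; lra.
  have WG : W (a, b) `<=` G.
    move=> y /Wr/= ay; apply: he; rewrite /dball/=.
    have := d_tri (u a) x y; move: hb ha b12 b2 ay.
    by set q := b.+1%:R^-1; set q2 := b.+2%:R^-1; lra.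
  exists (pickle (a, b)).+1 => //; exists (a, b); first by apply/sP.
  by apply: Wl; rewrite /= d_sym.
move=> r r0; have r1 : 0 <= r^-1 by rewrite invr_ge0 ltW.
pose k := Num.bound r^-1.
exists (pickle (inr k : seq (nat * nat) + nat)); rewrite /A pickleK /V.
case: cid2 => t /= /andP[t1 t2] _; exists t; split => //.
rewrite (lt_trans _ t1) ?invr_gt0//= (lt_trans t2)//.
rewrite -[ltRHS]invrK ltf_pV2 ?posrE ?invr_gt0//.
by apply: lt_trans (archi_boundP r1) _; rewrite ltr_nat.
Qed.

(** * From convergence of masses to convergence in M_O *)

Section Determining.
Context {A : nat -> set S}.
Hypothesis detA : determining A.
Context {m : MO d C} {n_ : nat -> MO d C}.
Hypothesis nA : forall i, mass (n_ k) (A i) @[k --> \oo] --> mass m (A i).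

Lemma near_mass_open {G e} : dopen d G -> bO G -> 0 < e ->
  \forall k \near \oo, mass m G - e < mass (n_ k) G.
Proof.
have [bA hG _] := detA => oG bG e0.
have [I [ndI IG]] := hG G oG (bO_BorelO bG).2.
have e2 : 0 < e / 2 by rewrite divr_gt0.
have := @mass_cvg_up m (A \o I); rewrite IG => /(_ bG (fun k => (bA _).1) ndI).
move=> /cvgr_gt /(_ (mass m G - e / 2)); rewrite ltrBlDr ltrDl => /(_ e2)[j _ /(_ j (leqnn j)) hj].
have := nA (I j) => /cvgr_gt /(_ (mass m (A (I j)) - e / 2)); rewrite ltrBlDr ltrDl => /(_ e2).
apply: filterS => k hk.
have : mass (n_ k) (A (I j)) <= mass (n_ k) G.
  by apply: mass_le => //; [case: (bA (I j))|move=> x Ax; rewrite -IG; exists j].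
by rewrite /= in hj; lra.
Qed.

Lemma near_mass_closed {F s e} : 0 < s -> dclosed d F -> F `<=` ~` Cr d C s -> 0 < e ->
  \forall k \near \oo, mass (n_ k) F < mass m F + e.
Proof.
have [bA _ hU] := detA => s0 cF Fs e0.
have [i [r [/andP[r0 rs] Ai]]] := hU s s0.
have bU : bO (A i) := bA i.
have FU : F `<=` A i.
  by move=> x /Fs; rewrite CrCE Ai /=; exact: lt_le_trans.
have bF : dborel d F := dborel_closed cF.
have e2 : 0 < e / 2 by rewrite divr_gt0.
have oUF : dopen d (A i `\` F).
  by apply: dopenD => //; rewrite Ai; exact: dopen_gt (lip1_distR C0).
have h1 := near_mass_open oUF (bOD bU bF) e2.
have := nA i => /cvgr_lt /(_ (mass m (A i) + e / 2)); rewrite ltrDl => /(_ e2) h2.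
apply: filterS2 h1 h2 => k; rewrite !massD//; lra.
Qed.

(** As [m] does not charge the sphere, all but [e / 4] of [K] is covered by finitely many open
    pieces in which any two points are less than [e] apart. A closed [F] is covered by the pieces
    meeting it, up to the uncovered part, and these pieces lie in its [e]-neighbourhood. Only the
    finitely many unions of pieces have to be controlled, so one bound on [k] serves all [F]. *)
Lemma near_prohorov {s e} : 0 < s -> mass m [set x | distR C x = s] = 0 -> 0 < e ->
  \forall k \near \oo, prohorov_r d C (proj1_sig m) (proj1_sig (n_ k)) s <= e.
Proof.
move=> s0 ms e0; have [u hu] := dense_seq.
have rdl := lip1_distR C0.
have e4 : 0 < e / 4 by rewrite divr_gt0.
pose K := ~` Cr d C s; have bK : bO K by exact: bO_CrC.
have cK : dclosed d K by exact: CrC_closed.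
pose K0 := [set x | s < distR C x].
have K0K : K0 `<=` K by rewrite /K CrCE => x /ltW.
have oK0 : dopen d K0 by exact: dopen_gt.
have bK0 : bO K0 by apply: (bO_sub _ K0K bK); exact: dborel_open.
have mK : mass m K = mass m K0.
  have : mass m (K `\` K0) = 0.
    rewrite -ms; congr mass; rewrite /K CrCE; apply/seteqP; split => x /=.
      by rewrite /K0 /= le_eqVlt => -[/orP[/eqP|]].
    by move=> xs; rewrite /setD /K0 /= xs lexx ltxx.
  by rewrite massD//; [lra|exact: dborel_open].
pose U j := [set x | d (u j) x < e / 2] `&` K0.
have oU j : dopen d (U j) by apply: dopenI => //; exact: dopen_lt (lip1_d _).
pose W L := \bigcup_(j in `I_L) U j.
have oW L : dopen d (W L) by apply: dopen_bigcup.
have WK0 L : W L `<=` K0 by move=> x [j _ []].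
have bW L : bO (W L) := bO_sub (dborel_open (oW L)) (WK0 L) bK0.
have UW : \bigcup_L W L = K0.
  apply/seteqP; split => [x [L _ /WK0]//|x Kx].
  have [j hj] := hu x (e / 2) ltac:(lra).
  exists j.+1 => //; exists j => /=; first exact: ltnSn.
  by split => //=; rewrite d_sym.
have ndW : nondecreasing_seq W.
  move=> i j ij; apply/subsetPset; apply: bigcup_subset => k /=.
  by move=> /leq_trans; apply.
have [L hL] : exists L, mass m K0 - e / 4 < mass m (W L).
  have := @mass_cvg_up m W; rewrite UW => /(_ bK0 (fun k => dborel_open (oW k)) ndW).
  move=> /cvgr_gt /(_ (mass m K0 - e / 4)); rewrite ltrBlDr ltrDl => /(_ e4)[j _ /(_ j (leqnn j)) hj].
  by exists j.
pose G (I : {set 'I_L}) := \bigcup_(j in [set j : 'I_L | j \in I]) U j.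
have oG I : dopen d (G I) by apply: dopen_bigcup.
have GK0 I : G I `<=` K0 by move=> x [j _ []].
have bG I : bO (G I) := bO_sub (dborel_open (oG I)) (GK0 I) bK0.
have nG : \forall k \near \oo, forall I, mass m (G I) - e / 4 < mass (n_ k) (G I).
  by apply: filter_forall => I; exact: near_mass_open.
have nK := near_mass_closed s0 cK (@subset_refl _ _) e4.
apply: filterS2 nG nK => k hG hK.
have half F : dclosed d F -> F `<=` K ->
    mass m F <= mass (n_ k) (nbhd_set d F e `&` K) + e / 2.
  move=> cF FK; have bF := bO_closed s0 cF FK.
  pose I := [set j : 'I_L | `[< U j `&` F !=set0 >]]%SET.
  have FG : F `<=` G I `|` K `\` W L.
    move=> x Fx; have [[j jL Ux]|nW] := pselect (W L x); last by right; split => //; exact: FK.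
    by left; exists (Ordinal jL) => //=; rewrite inE; apply/asboolP; exists x.
  have GF : G I `<=` nbhd_set d F e `&` K.
    move=> x [j /=]; rewrite inE => /asboolP[y [Uy Fy]] Ux; split; last by apply/K0K; case: Ux.
    rewrite nbhd_setE; exists y => //.
    by case: Ux Uy => /= + _ [/= + _]; have := d_tri (u j) x y; rewrite (d_sym x (u j)); lra.
  have bKW : bO (K `\` W L) by apply: bOD => //; exact: dborel_open.
  have h1 : mass m F <= mass m (G I) + mass m (K `\` W L).
    apply: le_trans (massU m (bG I) bKW); apply: mass_le => //; first by case: bF.
    exact: bOU.
  have h2 : mass (n_ k) (G I) <= mass (n_ k) (nbhd_set d F e `&` K).
    by apply: mass_le => //; [case: (bG I)|exact: bO_nbhd].
  have := hG I; move: h1; rewrite massD//; last 2 first.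
    exact: dborel_open.
    exact: subset_trans (WK0 L) K0K.
  by lra.
apply: prohorov_le => // F cF FK; rewrite -/K; split.
  by have := half F cF FK; lra.
(* the opposite inequality: apply [half] to [K `\` N], the total masses of [K]
   being close *)
pose N := nbhd_set d F e.
have oN : dopen d N := nbhd_set_open F e.
have bN : dborel d N := dborel_open oN.
have := half (K `\` N) (dclosedD cK oN) (@subDsetl _ _ _).
have bF := bO_closed s0 cF FK.
have hle : mass (n_ k) (nbhd_set d (K `\` N) e `&` K) <= mass (n_ k) (K `\` F).
  apply: mass_le; [exact: (bO_nbhd _ _ s0).1|exact: bOD bK bF.1|].
  move=> x [+ Kx]; rewrite nbhd_setE => -[y [Ky Ny] xy]; split => // Fx.
  by apply: Ny; rewrite /N nbhd_setE; exists x => //; rewrite d_sym.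
have : mass m (K `\` N) = mass m K - mass m (N `&` K).
  rewrite -massD//; last exact: dborelI bN bK.1.
  by congr mass; rewrite setDIr setDv setU0.
move: hle; rewrite (massD (n_ k) bK bF.1 FK); move: hK; rewrite -/K -/N.
by lra.
Qed.

(** Prohorov convergence holds at every radius whose sphere [m] does not charge, that is, off a
    countable set of radii; domination by the exponential density does the rest. *)
Lemma determining_cvg : dMO m (n_ k) @[k --> \oo] --> 0.
Proof.
pose p k r := prohorov_r d C (proj1_sig m) (proj1_sig (n_ k)) r.
have p0 k r : 0 <= p k r by exact: prohorov_ge0.
suff : (\int[@lebesgue_measure R]_r (dM_integrand_pos m (n_ k) r)%:E)%E @[k --> \oo] --> 0%E.
  move=> /fine_cvg; rewrite [X in X @ _](_ : _ = fun k => dMO m (n_ k))//.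
  by apply/funext => k; rewrite /= dMOE.
apply: (@lower_dominated_cvg0 _ _ _ (@lebesgue_measure R) (fun k => dM_integrand_pos m (n_ k)) (exponential_pdf 1)).
- by move=> k x; exact: dM_integrand_pos_ge0.
- by move=> k x; exact: dM_integrand_pos_le.
- exact: integrable_exponential_pdf.
pose Z := [set t | 0 < t /\ 0 < mass m [set x | distR C x = t]].
have cZ : countable Z.
  (* The mass near [C] may be infinite, so charged levels are counted separately above each
     [1 / (b + 1)]. *)
  have -> : Z = \bigcup_b [set t | b.+1%:R^-1 <= t /\ 0 < mass m [set x | distR C x = t]].
    apply/seteqP; split => [t [t0 mt]|t [b _ [bt mt]]]; last first.
      by split => //; apply: lt_le_trans bt; rewrite invr_gt0.
    have t1 : 0 <= t^-1 by rewrite invr_ge0 ltW.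
    exists (Num.bound t^-1) => //; split => //; apply: ltW.
    rewrite -[ltRHS]invrK ltf_pV2 ?posrE ?invr_gt0//.
    by apply: lt_trans (archi_boundP t1) _; rewrite ltr_nat.
  apply: bigcup_countable => // b _.
  have b0 : 0 < b.+1%:R^-1 :> R by rewrite invr_gt0.
  apply: (countable_levels m (fun t => b.+1%:R^-1 <= t) (lip1_distR C0) b0) => t /= bt.
  by rewrite CrCE => x /= ->.
exists Z; split.
- by apply: countable_measurable => // t; exact: measurable_set1.
- exact: countable_lebesgue_measure0.
move=> r /= nr; apply: contrapT => nZ; apply: nr.
have [r0|r0] := ltP 0 r; last first.
  rewrite [X in X @ _](_ : _ = cst 0); first exact: cvg_cst.
  apply/funext => k; rewrite /dM_integrand_pos patchE; case: ifPn => //.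
  by rewrite inE/= in_itv/= andbT ltNge r0.
rewrite [X in X @ _](_ : _ = fun k => dM_integrand m (n_ k) r); last first.
  by apply/funext => k; rewrite /dM_integrand_pos patchE ifT// inE/= in_itv/= andbT.
have mr : mass m [set x | distR C x = r] = 0.
  apply/eqP; rewrite eq_le mass_ge0 andbT leNgt; apply/negP => h.
  by apply: nZ.
apply: (@squeeze_cvgr _ _ _ _ (cst 0) (fun k => p k r)); last 2 first.
- exact: cvg_cst.
- apply/cvgrPdist_le => e e0; have := near_prohorov r0 mr e0.
  by apply: filterS => k; rewrite sub0r normrN ger0_norm.
apply: nearW => k; rewrite dM_integrand_ge0/= /dM_integrand -/(p k r).
rewrite -[leRHS]mul1r ler_pM ?expR_ge0//.
- by rewrite divr_ge0// addr_ge0.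
- by rewrite -expR0 ler_expR lerNl oppr0 ltW.
- by rewrite ler_pdivrMr; have := p0 k r; nra.
Qed.

End Determining.

(** * The two implications *)

Lemma continuous_entries {k} {g : 'rV[R]_k -> R} : continuous g ->
  forall (v : 'rV[R]_k) (e : R), 0 < e -> exists2 dl, 0 < dl &
    forall w : 'rV[R]_k, (forall i, `|v ord0 i - w ord0 i| < dl) -> `|g v - g w| < e.
Proof.
move=> cg v e e0.
have /cvgrPdist_lt/(_ e e0) := cg v.
move=> /nbhs_ballP[dl /= dl0 hdl]; exists dl => // w vw; apply: hdl.
by split => // i j; rewrite ord1; exact: vw.
Qed.

Lemma entries_continuous {k} {g : 'rV[R]_k -> R} :
  (forall (v : 'rV[R]_k) (e : R), 0 < e -> exists2 dl, 0 < dl &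
    forall w : 'rV[R]_k, (forall i, `|v ord0 i - w ord0 i| < dl) -> `|g v - g w| < e) ->
  continuous g.
Proof.
move=> h v; apply/(@cvgrPdist_lt _ _ _ (nbhs v) (nbhs_filter v)) => e e0.
have [dl dl0 hdl] := h v e e0.
apply/nbhs_ballP; exists dl => //= w [_ vw]; apply: hdl => i; exact: (vw ord0 i).
Qed.

Lemma fidiE m k (B : 'I_k -> set S) i : fidi m B ord0 i = mass m (B i).
Proof. by rewrite mxE. Qed.

(** The open set [{g > a}] is the union of the rational cubes it contains, so its preimage is a
    countable union of finite intersections of conditions on single masses. *)
Lemma measurable_fidi {k} {B : 'I_k -> set S} {g : 'rV[R]_k -> R} :
  (forall i, bO (B i)) -> continuous g ->
  measurable_fun setT (fun m : MOB d C => g (fidi m B)).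
Proof.
move=> bB /continuous_entries cg mD.
apply: (measurability _ (RGenOInfty.measurableE R)) => //.
move=> _ [_ [a ->] <-]; rewrite setTI.
pose near (q : 'rV[rat]_k * nat) (v : 'rV[R]_k) :=
  forall i, `|v ord0 i - ratr (q.1 ord0 i)| < q.2.+1%:R^-1.
pose Q := [set q | forall v, near q v -> a < g v].
have -> : (fun m : MOB d C => g (fidi m B)) @^-1` `]a, +oo[ =
    \bigcup_q (if q \in Q then \bigcap_(i in [set: 'I_k])
      [set m : MOB d C | `|mass m (B i) - ratr (q.1 ord0 i)| < q.2.+1%:R^-1] else set0).
  apply/seteqP; split => [m /=|m [q _]].
    rewrite in_itv/= andbT => am.
    have e0 : 0 < g (fidi m B) - a by rewrite subr_gt0.
    have [dl dl0 hdl] := cg (fidi m B) _ e0.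
    have dl1 : 0 <= 2 / dl by rewrite divr_ge0// ltW.
    pose p := Num.bound (2 / dl).
    have p0 : 0 < p.+1%:R^-1 :> R by rewrite invr_gt0.
    have pdl : 2 / p.+1%:R < dl.
      rewrite ltr_pdivrMr// mulrC -ltr_pdivrMr//.
      by apply: lt_trans (archi_boundP dl1) _; rewrite ltr_nat.
    have exq i : exists q : rat, `|mass m (B i) - ratr q| < p.+1%:R^-1.
      have [|q] := @rat_in_itvoo R (mass m (B i) - p.+1%:R^-1) (mass m (B i) + p.+1%:R^-1).
        by move: p0; set x := p.+1%:R^-1; lra.
      rewrite in_itv/= => /andP[q1 q2]; exists q; rewrite ltr_norml; move: q1 q2.
      by set x := p.+1%:R^-1; lra.
    pose q : 'rV[rat]_k := \row_i projT1 (cid (exq i)).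
    have qP i : `|mass m (B i) - ratr (q ord0 i)| < p.+1%:R^-1.
      by rewrite mxE; exact: projT2 (cid (exq i)).
    exists (q, p) => //; rewrite ifT; first by move=> i _; exact: qP.
    rewrite inE => v nv; have : `|g (fidi m B) - g v| < g (fidi m B) - a.
      apply: hdl => i; rewrite fidiE; apply: lt_trans pdl.
      have := nv i; have := qP i; rewrite /= distrC => h1 h2.
      rewrite -(subrKA (ratr (q ord0 i))).
      rewrite (le_lt_trans (ler_normD _ _))//.
      rewrite (distrC (mass m (B i))); rewrite (distrC (v ord0 i)) in h2.
      by move: h1 h2; set x := p.+1%:R^-1; lra.
    by rewrite ltr_norml; lra.
  case: ifPn => // qQ nm /=; rewrite in_itv/= andbT; rewrite inE in qQ.
  by apply: qQ => i; rewrite fidiE; exact: nm.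
apply: countable_bigcupT_measurable; first exact: countableP.
move=> q; case: ifPn => // _; apply: fin_bigcap_measurable => [|i _].
  exact: finite_finset.
have mf : measurable_fun setT (fun m : MOB d C => `|mass m (B i) - ratr (q.1 ord0 i)|).
  apply: measurableT_comp => //; apply: measurable_funB => //; exact: measurable_mass.
have := mf measurableT _ (measurable_itv `]-oo, (q.2.+1%:R^-1 : R)[).
by rewrite setTI; congr measurable; apply/seteqP; split => x /=; rewrite in_itv.
Qed.

Lemma dMcontinuousN {f : MO d C -> R} : dMcontinuous f -> dMcontinuous (fun m => - f m).
Proof.
move=> cf m e e0; have [dl dl0 h] := cf m e e0; exists dl => // n /h.
by rewrite -opprD normrN.
Qed.

Lemma dMcontinuous_cvg {f : MO d C -> R} {m} {t_ : nat -> MO d C} : dMcontinuous f ->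
  dMO m (t_ J) @[J --> \oo] --> 0 -> f (t_ J) @[J --> \oo] --> f m.
Proof.
move=> cf; move/cvgr_lt => mt; apply/cvgrPdist_lt => e e0.
have [dl dl0 h] := cf m e e0.
by apply: filterS (mt dl dl0) => J /h; rewrite distrC.
Qed.

Section FidiToWeak.
Context {P_ : nat -> probability (MOB d C) R} {P : probability (MOB d C) R}.
Hypothesis fidiP : fidi_conv P_ P.

Lemma fidi_liminf {f M} : dMcontinuous f -> (forall m, `|f m| <= M) ->
  forall e, 0 < e -> \forall n \near \oo, expect P f - e < expect (P_ n) f.
Proof.
move=> cf fM; have [A detA ASP] := determining_SP P.
pose w J (v : 'rV[R]_J.+1) (t : MO d C) := J.+1%:R * \sum_(i < J.+1) `|v ord0 i - mass t (A i)|.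
have w0 J v t : 0 <= w J v t by rewrite mulr_ge0// sumr_ge0.
(* At a [v] that is not a vector of masses the infimum may exceed [M]; the cap makes [g J] a bounded
   test function on the whole space, and by [g_reg] it changes nothing at actual vectors of
   masses. *)
pose g J v : R := Num.min M (reg f (w J v)).
pose fd J (m : MO d C) := fidi m (fun i : 'I_J.+1 => A i).
have g_reg J m : g J (fd J m) = reg f (w J (fd J m)).
  apply/min_idPr; apply: le_trans (reg_le fM m (w0 _ _)) _.
  rewrite [w _ _ _](_ : _ = 0) ?addr0; first by have := fM m; rewrite ler_norml => /andP[].
  by rewrite /w big1 ?mulr0// => i _; rewrite fidiE subrr normr0.
have M0 : 0 <= M by apply: le_trans (fM point).
have gM J v : `|g J v| <= M.
  rewrite ler_norml ge_min lexx/= andbT le_min; apply/andP; split; first by lra.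
  exact: (reg_ge fM (w0 J v)).
have cg J : continuous (g J).
  apply: entries_continuous => v e e0.
  (* One factor for the number of summands, one for the penalty factor. *)
  pose c : R := J.+1%:R * J.+1%:R.
  have c0 : 0 < c by rewrite mulr_gt0.
  exists (e / (2 * c)); first by rewrite divr_gt0// mulr_gt0.
  move=> v' vv'.
  have : `|reg f (w J v) - reg f (w J v')| <= e / 2.
    apply: (reg_lip fM (w0 J v) (w0 J v')) => t.
    rewrite /w -mulrBr normrM ger0_norm// -sumrB.
    rewrite (le_trans (ler_wpM2l _ (ler_norm_sum _ _ _)))//.
    apply: (@le_trans _ _ (J.+1%:R * \sum_(i < J.+1) (e / (2 * c)))).
      rewrite ler_wpM2l//; apply: ler_sum => i _.
      apply: le_trans (ltW (vv' i)).
      rewrite (le_trans (ler_dist_dist _ _))//.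
      by rewrite opprB addrA subrK.
    rewrite sumr_const card_ord -(mulr_natl (e / (2 * c))) mulrA -/c.
    have ce (x : R) : 0 < x -> x * (e / (2 * x)) = e / 2 by move=> x0; field; rewrite gt_eqF.
    by rewrite ce.
  set a := reg f (w J v); set b := reg f (w J v') => h.
  have := ler_norm (a - b); have := ler_norm (b - a); rewrite (distrC b) => ? ?.
  apply: (@le_lt_trans _ _ (e / 2)); last by lra.
  rewrite /g -/a -/b ler_distl /Num.min.
  by case: ltP => ?; case: ltP => ?; apply/andP; split; lra.
apply: (@expect_liminf _ _ _ P_ P f (fun J m => g J (fd J m)) M).
- by split; [exact: dMcontinuous_measurable|exists M].
- by move=> J; apply: measurable_fidi => // i; have /SPP[] := ASP i.
- by move=> J m; exact: gM.
- move=> J m; rewrite g_reg; apply: le_trans (reg_le fM m (w0 _ _)) _.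
  rewrite [w _ _ _](_ : _ = 0) ?addr0//.
  by rewrite /w big1 ?mulr0// => i _; rewrite fidiE subrr normr0.
- apply: aeW => m; under eq_cvg do rewrite g_reg.
  apply: (reg_cvg fM m); first by move=> J t; exact: w0.
    by move=> J; rewrite /w big1 ?mulr0// => i _; rewrite fidiE subrr normr0.
  move=> t_ ht; apply: dMcontinuous_cvg => //.
  apply: (determining_cvg detA) => i.
  have M2 : 0 <= 2 * M + 1 by lra.
  apply/cvgrPdist_lt => e e0.
  (* From [N] on, the term of index [i] occurs in the sum and the penalty factor exceeds
     [(2 * M + 1) / e]. *)
  pose N := maxn i (Num.bound ((2 * M + 1) / e)).
  exists N => // J /= NJ.
  have iJ : (i < J.+1)%N by rewrite ltnS (leq_trans _ NJ)// leq_maxl.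
  have : J.+1%:R * `|mass m (A i) - mass (t_ J) (A i)| <= 2 * M + 1.
    apply: le_trans (ht J); rewrite /w ler_wpM2l//.
    rewrite (bigD1 (Ordinal iJ))//= fidiE lerDl; exact: sumr_ge0.
  have : (2 * M + 1) / e < J.+1%:R.
    apply: lt_le_trans (archi_boundP (divr_ge0 M2 (ltW e0))) _.
    by rewrite ler_nat leqW// (leq_trans _ NJ)// leq_maxr.
  rewrite ltr_pdivrMr// => h1 h2.
  by rewrite -(@ltr_pM2l _ J.+1%:R)//; exact: le_lt_trans h1.
by move=> J; apply: fidiP => //; exists M.
Qed.

End FidiToWeak.

Lemma fidi_conv_weak_conv (P_ : nat -> probability (MOB d C) R) P :
  fidi_conv P_ P -> weak_conv P_ P.
Proof.
move=> h f [M fM] cf; apply: cvg_expect.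
- by split; [exact: dMcontinuous_measurable|exists M].
- exact: (fidi_liminf h cf fM).
- apply: (fidi_liminf h (dMcontinuousN cf) (M := M)) => m.
  by rewrite normrN.
Qed.

Lemma dMcontinuous_finite {k} {f : 'I_k -> MO d C -> R} : (forall i, dMcontinuous (f i)) ->
  forall m e, 0 < e -> exists2 dl, 0 < dl &
    forall n, dMO m n < dl -> forall i, `|f i n - f i m| < e.
Proof.
move=> cf m e e0.
have ex i : exists dl, 0 < dl /\ forall n, dMO m n < dl -> `|f i n - f i m| < e.
  by have [dl dl0 h] := cf i m e e0; exists dl.
pose dl i := projT1 (cid (ex i)).
have dlP i : 0 < dl i /\ forall n, dMO m n < dl i -> `|f i n - f i m| < e := projT2 (cid (ex i)).
exists (\big[Num.min/1]_i dl i).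
  by apply: lt_bigmin => // i _; case: (dlP i).
move=> n hn i; apply: (dlP i).2; apply: lt_le_trans hn _.
exact: bigmin_le.
Qed.

Lemma continuous_dinterior_dclosure {A} : bO A ->
  exists uv : (nat -> MO d C -> R) * (nat -> MO d C -> R),
  [/\ forall j, dMcontinuous (uv.1 j), forall j, dMcontinuous (uv.2 j),
      forall j m, uv.1 j m <= mass m A, forall j m, mass m A <= uv.2 j m &
      forall m, mass m (dboundary d A) = 0 ->
        uv.1 j m @[j --> \oo] --> mass m A /\ uv.2 j m @[j --> \oo] --> mass m A].
Proof.
move=> bA; have cA := bO_dclosure bA.2.
have bI : bO (dinterior d A).
  by apply: (bO_sub _ (dinterior_sub A) bA); exact: dborel_open (dinterior_open A).
have [u [cu uA lu]] := lower_approx (dinterior_open A) bI.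
have [v [cv vA lv]] := upper_approx (dclosure_closed A) cA.
exists (u, v) => /=.
have leI m : mass m (dinterior d A) <= mass m A.
  by apply: mass_le (dinterior_sub A) => //; case: bI.
have leC m : mass m A <= mass m (dclosure d A).
  by apply: mass_le (@sub_dclosure A) => //; case: bA.
split=> //.
- by move=> j m; apply: le_trans (leI m).
- by move=> j m; apply: le_trans (leC m) _.
move=> m m0.
have IC : dinterior d A `<=` dclosure d A by apply: subset_trans (@sub_dclosure A); exact: dinterior_sub.
have : mass m (dclosure d A) - mass m (dinterior d A) = 0 by rewrite -massD//; case: bI.
move=> e0.
have h := leI m; have h' := leC m.
rewrite (_ : mass m A = mass m (dclosure d A)); last by lra.
by split => //; rewrite (_ : mass m (dclosure d A) = mass m (dinterior d A))//; lra.
Qed.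

Section WeakToFidi.
Context {P_ : nat -> probability (MOB d C) R} {P : probability (MOB d C) R}.
Hypothesis weakP : weak_conv P_ P.
Context {k : nat} {A : 'I_k -> set S}.
Hypothesis ASP : forall i, SP P (A i).

Lemma weak_liminf {g : 'rV[R]_k -> R} {M} : continuous g -> (forall v, `|g v| <= M) ->
  forall e, 0 < e -> \forall n \near \oo,
    expect P (fun m => g (fidi m A)) - e < expect (P_ n) (fun m => g (fidi m A)).
Proof.
move=> cg gM.
have bA i : bO (A i) by have /SPP[] := ASP i.
have PA i : Pnull P (dboundary d (A i)) by have /SPP[] := ASP i.
pose uv i := projT1 (cid (continuous_dinterior_dclosure (bA i))).
have uvP i := projT2 (cid (continuous_dinterior_dclosure (bA i))).
pose u i := (uv i).1; pose v i := (uv i).2.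
have cu i j : dMcontinuous (u i j) by case: (uvP i) => h _ _ _ _; exact: h.
have cv i j : dMcontinuous (v i j) by case: (uvP i) => _ h _ _ _; exact: h.
have uA i j m : u i j m <= mass m (A i) by case: (uvP i) => _ _ h _ _; exact: h.
have vA i j m : mass m (A i) <= v i j m by case: (uvP i) => _ _ _ h _; exact: h.
have uvlim i m : mass m (dboundary d (A i)) = 0 ->
    u i j m @[j --> \oo] --> mass m (A i) /\ v i j m @[j --> \oo] --> mass m (A i).
  by case: (uvP i) => _ _ _ _ h; exact: h.
pose h (m : MO d C) := g (fidi m A).
have hM m : `|h m| <= M by exact: gM.
pose pos (x : R) : R := Num.max 0 x.
have pos_ge0 x : 0 <= pos x by rewrite le_max lexx.
have pos_ge x : x <= pos x by rewrite le_max lexx orbT.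
have pos_lip x y : `|pos x - pos y| <= `|x - y|.
  have := ler_norm (x - y); have := ler_norm (y - x); rewrite (distrC y x) => ? ?.
  rewrite /pos ler_distl; apply/andP.
  by split; rewrite /Num.max; case: ltP => h1; case: ltP => h2; have := normr_ge0 (x - y); lra.
(* Since [u i J m <= v i J m], at most one positive part is nonzero and their sum is the distance
   from [mass t (A i)] to the interval. Only the continuous [u] and [v] involve [m]. *)
pose w J m t := J.+1%:R * \sum_(i < k) (pos (u i J m - mass t (A i)) + pos (mass t (A i) - v i J m)).
have w0 J m t : 0 <= w J m t.
  by rewrite mulr_ge0// sumr_ge0// => i _; rewrite addr_ge0.
have wm J m : w J m m = 0.
  rewrite /w big1 ?mulr0// => i _.
  rewrite /pos !max_l ?addr0//; first by have := vA i J m; lra.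
  by have := uA i J m; lra.
have h_le J m : reg h (w J m) <= h m.
  by have := reg_le hM m (w0 J m); rewrite wm addr0.
have ch J : dMcontinuous (fun m => reg h (w J m)).
  move=> m e e0.
  (* The 2 counts the positive parts per index; [k + 1] in place of [k] keeps [c] positive when [k]
     is 0. *)
  pose c : R := J.+1%:R * (2 * k.+1%:R).
  have c0 : 0 < c by rewrite !mulr_gt0.
  have ec : 0 < e / (2 * c) by rewrite divr_gt0// mulr_gt0.
  have [d1 d10 hd1] := dMcontinuous_finite (fun i => cu i J) m _ ec.
  have [d2 d20 hd2] := dMcontinuous_finite (fun i => cv i J) m _ ec.
  exists (Num.min d1 d2); first by rewrite lt_min d10.
  move=> n; rewrite lt_min => /andP[/hd1 un /hd2 vn].
  have : `|reg h (w J n) - reg h (w J m)| <= e / 2.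
    apply: (reg_lip hM (w0 J n) (w0 J m)) => t.
    rewrite /w -mulrBr normrM ger0_norm// -sumrB.
    rewrite (le_trans (ler_wpM2l _ (ler_norm_sum _ _ _)))//.
    apply: (@le_trans _ _ (J.+1%:R * \sum_(i < k) (2 * (e / (2 * c))))).
      rewrite ler_wpM2l//; apply: ler_sum => i _.
      rewrite opprD addrACA (le_trans (ler_normD _ _))// mulr_natl mulr2n.
      apply: lerD; apply: le_trans (pos_lip _ _) _.
        by rewrite opprB addrA subrK ltW.
      by rewrite opprB [_ - v i J n + _]addrC addrA subrK distrC ltW.
    rewrite sumr_const card_ord -(mulr_natl (2 * (e / (2 * c)))).
    have ce (x : R) : 0 < x -> x * (e / (2 * x)) = e / 2 by move=> x0; field; rewrite gt_eqF.
    rewrite -[leRHS](ce c c0) /c.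
    set q := e / _; have q0 : 0 <= q by rewrite ltW.
    rewrite mulrA [_ * (2 * q)]mulrA ler_wpM2r// -mulrA ler_wpM2l//.
    by rewrite mulrC ler_wpM2l// ler_nat.
  by move=> /le_lt_trans; apply; lra.
apply: (@expect_liminf _ _ _ P_ P h (fun J m => reg h (w J m)) M).
- by split; [exact: measurable_fidi|exists M].
- by move=> J; exact: dMcontinuous_measurable.
- move=> J m; rewrite ler_norml (reg_ge hM (w0 J m))/=.
  by apply: le_trans (h_le J m) _; have := hM m; rewrite ler_norml => /andP[].
- exact: h_le.
- have aeA : {ae P, forall m : MOB d C, forall i, mass m (dboundary d (A i)) = 0}.
    by apply: filter_forall => i; exact: PA.
  apply: filterS aeA => m mA.
  apply: (reg_cvg hM m) => [J t|J|t_ ht]; [exact: w0|exact: wm|].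
  rewrite /h.
  have tA i : mass (t_ J) (A i) @[J --> \oo] --> mass m (A i).
    have [ul vl] := uvlim i m (mA i).
    pose c := 2 * M + 1.
    have bnd J : pos (u i J m - mass (t_ J) (A i)) + pos (mass (t_ J) (A i) - v i J m) <= c * J.+1%:R^-1.
      rewrite ler_pdivlMr// mulrC; apply: le_trans (ht J); rewrite /w ler_wpM2l//.
      by rewrite (bigD1 i)//= lerDl sumr_ge0// => j _; rewrite addr_ge0.
    have c0 : c * J.+1%:R^-1 @[J --> \oo] --> (0 : R).
      by rewrite -[X in _ --> X](mulr0 c); apply: cvgMr; exact: cvg_harmonic.
    (* A bounded total penalty leaves the mass at most [c / (J + 1)] outside the interval, whose
       ends converge to [mass m (A i)] as the boundary is not charged. *)
    apply: (@squeeze_cvgr _ _ _ _ (fun J => u i J m - c * J.+1%:R^-1) (fun J => v i J m + c * J.+1%:R^-1)).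
    - apply: nearW => J; have := bnd J; set q := c * _.
      have := pos_ge0 (u i J m - mass (t_ J) (A i)); have := pos_ge (u i J m - mass (t_ J) (A i)).
      have := pos_ge0 (mass (t_ J) (A i) - v i J m); have := pos_ge (mass (t_ J) (A i) - v i J m).
      by lra.
    - by rewrite -[X in _ --> X]subr0; apply: cvgB.
    - by rewrite -[X in _ --> X]addr0; apply: cvgD.
  apply/cvgrPdist_lt => e e0; have [dl dl0 hdl] := continuous_entries cg (fidi m A) e e0.
  have : \forall J \near \oo, forall i, `|mass m (A i) - mass (t_ J) (A i)| < dl.
    by apply: filter_forall => i; have /cvgrPdist_lt := tA i; apply.
  by apply: filterS => J hJ; apply: hdl => i; rewrite !fidiE.
move=> J; apply: weakP => //; exists M => m.
rewrite ler_norml (reg_ge hM (w0 J m))/=.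
by apply: le_trans (h_le J m) _; have := hM m; rewrite ler_norml => /andP[].
Qed.

End WeakToFidi.

Lemma weak_conv_fidi_conv (P_ : nat -> probability (MOB d C) R) P :
  weak_conv P_ P -> fidi_conv P_ P.
Proof.
move=> h k k0 A ASP g [M gM] cg; apply: cvg_expect.
- split; last by exists M.
  by apply: measurable_fidi => // i; have /SPP[] := ASP i.
- exact: (weak_liminf h ASP cg gM).
apply: (weak_liminf h ASP (g := fun v => - g v) (M := M)) => [|v]; last by rewrite normrN.
apply: entries_continuous => v e e0.
have [dl dl0 hdl] := continuous_entries cg v e e0; exists dl => // w /hdl.
by rewrite -opprD normrN.
Qed.

End Space.

(** * The equivalence, and the case of an empty space *)

Lemma weak_conv_iff_fidi_conv (R : realType) (S : pointedType) (d : S -> S -> R)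
  (C : set S) (smul : R -> S -> S)
  (hmetric : is_metric d) (hsep : dseparable d)
  (hsmul : smul_axioms d C smul) (hcone : closed_cone d C smul)
  (P_ : nat -> probability (MOB d C) R) (P : probability (MOB d C) R) :
  weak_conv P_ P <-> fidi_conv P_ P.
Proof.
have C0 : C !=set0.
  have [Cp|nCp] := pselect (C point); first by exists point.
  (* Distances to an empty [C] are all [+oo], which contradicts their strict increase under
     scaling. *)
  have [_ _ _ /(_ point 0 1 nCp (lexx _) ltr01)] := hsmul.
  move=> /lt_le_trans/(_ (leey _))/ereal_inf_lt[_ [y Cy _] _].
  by exists y.
have [Cc _] := hcone.
split; first exact: (weak_conv_fidi_conv d hmetric C Cc C0).
exact: (fidi_conv_weak_conv d hmetric C Cc C0 hsep).
Qed.

(** Serves the empty space, which has no base point: there the only measure is zero. *)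
Lemma MO_subsingleton (R : realType) (S : Type) (d : S -> S -> R) (C : set S) :
  (S -> False) -> forall m n : MO d C, m = n.
Proof.
move=> S0 [m mP] [n nP].
have mn : m = n.
  apply/funext => A; have -> : A = set0 by apply/seteqP; split => // x.
  by case: mP => _ _ -> _ _; case: nP => _ _ -> _ _.
by subst n; congr exist; exact: Prop_irrelevance.
Qed.

Theorem mainTheorem12 (R : realType) (S : Type) (d : S -> S -> R)
  (C : set S) (smul : R -> S -> S)
  (hmetric : is_metric d) (hcomplete : dcomplete d) (hsep : dseparable d)
  (hsmul : smul_axioms d C smul) (hcone : closed_cone d C smul)
  (P_ : nat -> probability (MOB d C) R) (P : probability (MOB d C) R) :
  weak_conv P_ P <-> fidi_conv P_ P.
Proof.
have [[x0]|S0] := pselect (inhabited S).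
  (* The base point occurs neither in [MO] nor in the two notions of convergence, so the result over
     [pS] is the result over [S]. *)
  pose pS : pointedType := HB.pack S (gen_eqMixin S) (gen_choiceMixin S) (isPointed.Build S x0).
  exact: (@weak_conv_iff_fidi_conv R pS d C smul).
(* With a single measure in [MO] every integrand is constant, and both sides of the equivalence
   hold. *)
have int_cst (Q : probability (MOB d C) R) (f : MO d C -> R) :
    (\int[Q]_x (f x)%:E = (f point)%:E)%E.
  rewrite (_ : (fun x => (f x)%:E) = cst (f point)%:E).
    rewrite integral_cst// -[RHS]mule1; congr (_ * _)%E.
    exact: (@probability_setT _ (MOB d C) R Q).
  apply/funext => m.
  by rewrite [m](@MO_subsingleton R S d C (fun x => S0 (inhabits x)) m point).
have cvg_int (f : MO d C -> R) :
    (fun n => \int[P_ n]_x (f x)%:E)%E @ \oo --> (\int[P]_x (f x)%:E)%E.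
  rewrite int_cst (_ : (fun n => _) = cst (f point)%:E); first exact: cvg_cst.
  by apply/funext => n; exact: int_cst.
split=> [_ k _ A _ g _ _|_ f _ _]; last exact: cvg_int.
exact: (cvg_int (fun x => g (fidi x A))).
Qed.
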